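(* (1) $s_4 Q_4 s_4^{-1} \subset Q_5^{(1.5)}$ and $s_4^{-1} Q_4 s_4 \subset Q_5^{(1.5)}$. (2) $Q_5^{(2)} = Q_5^{(1.5)} + R\, s_4w_+s_4 + R\, s_4^{-1}w_-s_4^{-1} + R\, s_4w_-s_4 + R\, s_4^{-1}w_+s_4^{-1}$. Moreover, for all $X \in \{ s_4w_+s_4,\ s_4^{-1}w_-s_4^{-1},\ s_4w_-s_4,\ s_4^{-1}w_+s_4^{-1} \}$ and all $\lambda \in Q_4$, we have $\lambda X \equiv X\lambda \equiv \varepsilon(\lambda)X \mod Q_5^{(1.5)}$, where $\varepsilon : Q_4 \to R$ is the $R$-algebra morphism induced by $s_i \mapsto a$.
   Context: $R=\mathbb{Z}[a^{\pm1},b^{\pm1},c^{\pm1}]$. $B_n$ is the braid group with Artin generators $s_1,\dots,s_{n-1}$. For $n\ge 3$, $Q_n$ is the quotient of $RB_n$ by the relations $(s_1-a)(s_1-b)(s_1-c)=0$ and $$s_1^{-1}s_2s_1 = s_1 s_2 s_1^{-1} - a^{-1} s_1 s_2 + a s_1 s_2^{-1} + a s_1^{-1}s_2 - a^3 s_1^{-1} s_2^{-1}+ a^{-1} s_2 s_1 - a s_2 s_1^{-1} - a s_2^{-1} s_1 + a^3 s_2^{-1}s_1^{-1} + a^2 s_1^{-1} s_2^{-1} s_1- a^2 s_1 s_2^{-1} s_1^{-1}.$$ $Q_5$ is regarded as a $Q_4$-bimodule via the natural morphism $Q_4\to Q_5$ (products such as $s_4Q_4s_4^{-1}$ use the image of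 $Q_4$ in $Q_5$). $u_4=R+Rs_4+Rs_4^{-1}\subset Q_5$, and $Q_5^{(2)} = Q_4u_4Q_4u_4Q_4$ ($R$-span of products). $w_+ = s_3 s_2 s_1^{-1} s_2 s_3$ and $w_- = s_3^{-1} s_2^{-1} s_1 s_2^{-1} s_3^{-1}$. $Q_5^{(1.5)}$ is the $Q_4$-subbimodule of $Q_5$ generated by $1,\ s_4,\ s_4^{-1},\ s_4s_3^{-1}s_4,\ s_4s_3s_2^{-1}s_3s_4,\ s_4^{-1}s_3^{-1}s_2s_3^{-1}s_4^{-1}$. *)

(* Defs.v *)
From HB Require Import structures.
From mathcomp Require Import all_boot all_order all_algebra.
From mathcomp Require Import finmap boolp classical_sets.
From mathcomp Require Import monalg ring.

Set Implicit Arguments.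
Unset Strict Implicit.
Unset Printing Implicit Defensive.

Import GRing.Theory.

Local Open Scope ring_scope.
Local Open Scope classical_set_scope.
Local Open Scope quotient_scope.

(* The group algebra R G: finitely supported functions G -> R (the library's   *)
(* {malg R[G]}) with the convolution product. The ring structure of {malg R[K]} *)
(* in the library excludes monoids with nontrivial invertible elements, hence  *)
(* the alias.                                                                  *)
Definition galg (R : nzRingType) (G : groupType) := {malg R[G]}.

Section GroupAlgebra.
Variables (R : nzRingType) (G : groupType).
Local Open Scope fset_scope.
Implicit Types (x y z : {malg R[G]}) (k l : G) (c d : R).

HB.instance Definition _ := GRing.Lmodule.copy (galg R G) {malg R[G]}.

Definition gdelta k : galg R G := << 1 *g k >>.

Definition galg_mul x y : {malg R[G]} :=
  \sum_(k <- msupp x) \sum_(l <- msupp y) << x@_k * y@_l *g (k * l)%g >>.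

Definition galg_lin (V : lmodType R) (h : G -> V) x : V :=
  \sum_(k <- msupp x) x@_k *: h k.

Lemma galg_linw (V : lmodType R) (h : G -> V) (d : {fset G}) x :
  msupp x `<=` d -> galg_lin h x = \sum_(k <- d) x@_k *: h k.
Proof.
move=> le_d; rewrite [LHS](big_fset_incl _ le_d) //= => k _ /mcoeff_outdom ->.
by rewrite scale0r.
Qed.

Lemma galg_linP (V : lmodType R) (h : G -> V) : linear (galg_lin h).
Proof.
move=> c x y; pose d := msupp x `|` msupp y.
have dx : msupp x `<=` d by exact: fsubsetUl.
have dy : msupp y `<=` d by exact: fsubsetUr.
have dxy : msupp (c *: x + y) `<=` d.
  apply: fsubset_trans (msuppD_le _ _) _.
  by rewrite fsubUset dy andbT (fsubset_trans (msuppZ_le _ _)).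
rewrite (galg_linw _ dx) (galg_linw _ dy) (galg_linw _ dxy) scaler_sumr.
rewrite -big_split; apply: eq_bigr => k _ /=.
by rewrite mcoeffD mcoeffZ scalerDl scalerA.
Qed.

Lemma galg_linU (V : lmodType R) (h : G -> V) c k :
  galg_lin h << c *g k >> = c *: h k.
Proof. by rewrite (galg_linw _ msuppU_le) big_seq_fset1 mcoeffUU. Qed.

Lemma galg_mulw (d1 d2 : {fset G}) x y :
  msupp x `<=` d1 -> msupp y `<=` d2 ->
  galg_mul x y = \sum_(k <- d1) \sum_(l <- d2) << x@_k * y@_l *g (k * l)%g >>.
Proof.
move=> le1 le2; rewrite /galg_mul (big_fset_incl _ le1) /=.
  apply: eq_bigr => k _; apply: big_fset_incl => // l _ /mcoeff_outdom ->.
  by rewrite mulr0 monalgU0.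
move=> k _ /mcoeff_outdom xk.
by rewrite big1 // => l _; rewrite xk mul0r monalgU0.
Qed.

Lemma galg_mulDl : left_distributive galg_mul +%R.
Proof.
move=> x y z; pose d := msupp x `|` msupp y.
have dx : msupp x `<=` d by exact: fsubsetUl.
have dy : msupp y `<=` d by exact: fsubsetUr.
rewrite (galg_mulw dx (fsubset_refl _)) (galg_mulw dy (fsubset_refl _)).
rewrite (galg_mulw (msuppD_le _ _) (fsubset_refl _)).
rewrite -big_split; apply: eq_bigr => k _; rewrite -big_split.
by apply: eq_bigr => l _; rewrite /= mcoeffD mulrDl monalgUD.
Qed.

Lemma galg_mulDr : right_distributive galg_mul +%R.
Proof.
move=> z x y; pose d := msupp x `|` msupp y.
have dx : msupp x `<=` d by exact: fsubsetUl.
have dy : msupp y `<=` d by exact: fsubsetUr.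
rewrite (galg_mulw (fsubset_refl _) dx) (galg_mulw (fsubset_refl _) dy).
rewrite (galg_mulw (fsubset_refl _) (msuppD_le _ _)).
rewrite -big_split; apply: eq_bigr => k _; rewrite -big_split.
by apply: eq_bigr => l _; rewrite /= mcoeffD mulrDr monalgUD.
Qed.

Lemma galg_mul0 x : galg_mul 0 x = 0.
Proof. by rewrite /galg_mul msupp0 big_seq_fset0. Qed.

Lemma galg_mulr0 x : galg_mul x 0 = 0.
Proof. by rewrite /galg_mul big1 // => k _; rewrite msupp0 big_seq_fset0. Qed.

Lemma galg_mulUU c d k l :
  galg_mul << c *g k >> << d *g l >> = << c * d *g (k * l)%g >>.
Proof. by rewrite (galg_mulw msuppU_le msuppU_le) !big_seq_fset1 !mcoeffUU. Qed.

Lemma galg_suml (I : Type) (r : seq I) (F : I -> {malg R[G]}) x :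
  galg_mul (\sum_(i <- r) F i) x = \sum_(i <- r) galg_mul (F i) x.
Proof.
exact: (big_morph (galg_mul^~ x) (fun a b => galg_mulDl a b x) (galg_mul0 x)).
Qed.

Lemma galg_sumr (I : Type) (r : seq I) (F : I -> {malg R[G]}) x :
  galg_mul x (\sum_(i <- r) F i) = \sum_(i <- r) galg_mul x (F i).
Proof. exact: (big_morph (galg_mul x) (galg_mulDr x) (galg_mulr0 x)). Qed.

Lemma galg_mulA : associative galg_mul.
Proof.
move=> x y z; rewrite (monalgE x) galg_suml.
rewrite [X in _ = galg_mul X _]galg_suml galg_suml; apply: eq_bigr => k _.
rewrite (monalgE y) [X in galg_mul _ X = _]galg_suml galg_sumr.
rewrite [X in _ = galg_mul X _]galg_sumr galg_suml; apply: eq_bigr => l _.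
rewrite (monalgE z) !galg_sumr; apply: eq_bigr => m _.
by rewrite !galg_mulUU mulrA mulgA.
Qed.

Lemma galg_mul1 : left_id (gdelta 1%g) galg_mul.
Proof.
move=> x; rewrite [in LHS](monalgE x) galg_sumr [RHS](monalgE x).
by apply: eq_bigr => k _; rewrite galg_mulUU mul1r mul1g.
Qed.

Lemma galg_mulr1 : right_id (gdelta 1%g) galg_mul.
Proof.
move=> x; rewrite [in LHS](monalgE x) galg_suml [RHS](monalgE x).
by apply: eq_bigr => k _; rewrite galg_mulUU mulr1 mulg1.
Qed.

Lemma galg_nz : gdelta 1%g != 0 :> galg R G.
Proof.
apply/eqP => /malgP /(_ 1%g) /eqP.
by rewrite mcoeffUU mcoeff0 oner_eq0.
Qed.

HB.instance Definition _ := GRing.Zmodule_isNzRing.Build (galg R G)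
  galg_mulA galg_mul1 galg_mulr1 galg_mulDl galg_mulDr galg_nz.

Lemma galg_scaleU c d k : c *: << d *g k >> = << c * d *g k >> :> {malg R[G]}.
Proof. by apply/malgP => l; rewrite mcoeffZ !mcoeffU mulrnAr. Qed.

Lemma gdeltaM k l : gdelta (k * l)%g = gdelta k * gdelta l.
Proof. by rewrite [RHS]galg_mulUU mulr1. Qed.

Lemma gdelta1 : gdelta 1%g = 1. Proof. by []. Qed.

Lemma galg_scalerAl c (x y : galg R G) : c *: (x * y) = (c *: x) * y.
Proof.
change (c *: galg_mul x y = galg_mul (c *: (x : {malg R[G]})) y).
rewrite (galg_mulw (msuppZ_le c x) (fsubset_refl _)) scaler_sumr.
apply: eq_bigr => k _; rewrite scaler_sumr; apply: eq_bigr => l _.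
by rewrite galg_scaleU mcoeffZ mulrA.
Qed.

HB.instance Definition _ :=
  GRing.Lmodule_isLalgebra.Build R (galg R G) galg_scalerAl.

End GroupAlgebra.

Section GroupAlgebraCom.
Variables (R : comNzRingType) (G : groupType).

Lemma galg_scalerAr (c : R) (x y : galg R G) : c *: (x * y) = x * (c *: y).
Proof.
change (c *: galg_mul x y = galg_mul x (c *: (y : {malg R[G]}))).
rewrite (galg_mulw (fsubset_refl _) (msuppZ_le c y)) scaler_sumr.
apply: eq_bigr => k _; rewrite scaler_sumr; apply: eq_bigr => l _.
by rewrite galg_scaleU mcoeffZ mulrCA.
Qed.

HB.instance Definition _ :=
  GRing.Lalgebra_isAlgebra.Build R (galg R G) galg_scalerAr.

Lemma galg_lift_monoid (A : algType R) (h : G -> A) :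
  h 1%g = 1 -> {morph h : k l / (k * l)%g >-> k * l} ->
  monoid_morphism (galg_lin h : galg R G -> A).
Proof.
move=> h1 hM; split=> [|x y]; first by rewrite galg_linU scale1r.
have Dl : {morph galg_lin h : u v / u + v}.
  by move=> u v; rewrite -[u]scale1r galg_linP !scale1r.
have L0 : galg_lin h 0 = 0 by rewrite /galg_lin msupp0 big_seq_fset0.
change (galg_lin h (galg_mul x y) = galg_lin h x * galg_lin h y).
rewrite /galg_mul (big_morph _ Dl L0) /galg_lin mulr_suml.
apply: eq_bigr => k _; rewrite -/(galg_lin h _) (big_morph _ Dl L0) mulr_sumr.
apply: eq_bigr => l _.
by rewrite galg_linU hM -scalerAl -scalerAr scalerA.
Qed.

End GroupAlgebraCom.

(* The braid group B_n, by Artin's presentation. The generator s_{i+1} is      *)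
(* indexed by i : 'I_n.-1; the letter (i, true) stands for the generator and   *)
(* (i, false) for its inverse.                                                 *)
Section BraidGroup.
Variable n : nat.

Definition braid_letter : Type := ('I_n.-1 * bool)%type.
Definition braid_word : Type := seq braid_letter.
HB.instance Definition _ := Choice.copy braid_word (seq ('I_n.-1 * bool)).

Inductive braid_eq : braid_word -> braid_word -> Prop :=
| braid_refl w : braid_eq w w
| braid_sym u v : braid_eq u v -> braid_eq v u
| braid_trans u v w : braid_eq u v -> braid_eq v w -> braid_eq u w
| braid_cat u u' v v' :
    braid_eq u u' -> braid_eq v v' -> braid_eq (u ++ v) (u' ++ v')
| braid_cancel i e : braid_eq [:: (i, e); (i, ~~ e)] [::]
| braid_comm (i j : 'I_n.-1) : (i.+1 < j)%N ->
    braid_eq [:: (i, true); (j, true)] [:: (j, true); (i, true)]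
| braid_artin (i j : 'I_n.-1) : j = i.+1 :> nat ->
    braid_eq [:: (i, true); (j, true); (i, true)]
             [:: (j, true); (i, true); (j, true)].

Definition braid_rel : rel braid_word := fun u v => `[< braid_eq u v >].

Lemma braid_rel_refl : reflexive braid_rel.
Proof. by move=> u; apply/asboolP; exact: braid_refl. Qed.

Lemma braid_rel_sym : symmetric braid_rel.
Proof. by move=> u v; apply/asboolP/asboolP; exact: braid_sym. Qed.

Lemma braid_rel_trans : transitive braid_rel.
Proof.
by move=> v u w /asboolP uv /asboolP vw; apply/asboolP; exact: braid_trans vw.
Qed.

Canonical braid_equiv :=
  EquivRel braid_rel braid_rel_refl braid_rel_sym braid_rel_trans.

Definition braid : Type := {eq_quot braid_equiv}.
HB.instance Definition _ := Choice.on braid.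
HB.instance Definition _ := EqQuotient.on braid.

Lemma braidP u v : (\pi_braid u = \pi_braid v) <-> braid_eq u v.
Proof.
by split=> [/eqmodP/asboolP//|uv]; apply/eqmodP/asboolP.
Qed.

Lemma braidW (P : braid -> Prop) : (forall u, P (\pi_braid u)) -> forall g, P g.
Proof. by move=> Ppi g; rewrite -[g]reprK. Qed.

Lemma braid_reprK u : braid_eq (repr (\pi_braid u)) u.
Proof. by apply/braidP; rewrite reprK. Qed.

Definition word_inv (w : braid_word) : braid_word :=
  rev [seq (x.1, ~~ x.2) | x <- w].

Lemma word_invl w : braid_eq (word_inv w ++ w) [::].
Proof.
elim: w => [|[i e] w ih] /=; first exact: braid_refl.
rewrite /word_inv /= rev_cons cat_rcons.
apply: (braid_trans _ ih); apply: braid_cat; first exact: braid_refl.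
apply: (@braid_cat [:: _; _] [::]); last exact: braid_refl.
by rewrite -[e in X in _ :: X]negbK; exact: braid_cancel.
Qed.

Lemma word_invK : involutive word_inv.
Proof.
move=> w; rewrite /word_inv map_rev revK -map_comp -[RHS]map_id.
by apply: eq_map => -[i e] /=; rewrite negbK.
Qed.

Lemma word_invr w : braid_eq (w ++ word_inv w) [::].
Proof. by rewrite -{1}[w]word_invK; exact: word_invl. Qed.

Definition braid_one : braid := \pi_braid [::].
Definition braid_mul (g h : braid) : braid := \pi_braid (repr g ++ repr h).
Definition braid_inv (g : braid) : braid := \pi_braid (word_inv (repr g)).

Lemma braid_mulE u v :
  braid_mul (\pi_braid u) (\pi_braid v) = \pi_braid (u ++ v).
Proof. by apply/braidP; apply: braid_cat; exact: braid_reprK. Qed.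

Lemma braid_mulA : associative braid_mul.
Proof.
by move=> u v w; elim/braidW: u => u; elim/braidW: v => v; elim/braidW: w => w;
  rewrite !braid_mulE catA.
Qed.

Lemma braid_mul1 : left_id braid_one braid_mul.
Proof. by move=> u; elim/braidW: u => u; rewrite braid_mulE. Qed.

Lemma braid_mulr1 : right_id braid_one braid_mul.
Proof. by move=> u; elim/braidW: u => u; rewrite braid_mulE cats0. Qed.

Lemma braid_mulV : left_inverse braid_one braid_inv braid_mul.
Proof.
move=> g; rewrite -{2}[g]reprK braid_mulE; apply/braidP; exact: word_invl.
Qed.

Lemma braid_mulrV : right_inverse braid_one braid_inv braid_mul.
Proof.
move=> g; rewrite -{1}[g]reprK braid_mulE; apply/braidP; exact: word_invr.
Qed.

HB.instance Definition _ := isGroup.Build braid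
  braid_mulA braid_mul1 braid_mulr1 braid_mulV braid_mulrV.

Definition braid_gen (i : 'I_n.-1) : braid := \pi_braid [:: (i, true)].

Lemma braid_genV i : (braid_gen i)^-1%g = \pi_braid [:: (i, false)].
Proof.
apply: (mulgI (braid_gen i)); rewrite mulgV; apply/esym.
by rewrite [LHS]braid_mulE; apply/braidP; exact: (braid_cancel i true).
Qed.

(* The morphism from B_n to the multiplicative monoid of a ring A which maps   *)
(* the generators to x and their inverses to y.                                *)
Section Lift.
Variables (A : pzRingType) (x y : 'I_n.-1 -> A).

Definition word_eval (w : braid_word) : A :=
  \prod_(l <- w) (if l.2 then x l.1 else y l.1).

Definition braid_lift (g : braid) : A := word_eval (repr g).

Hypotheses (xy : forall i, x i * y i = 1) (yx : forall i, y i * x i = 1).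
Hypothesis xC : forall i j : 'I_n.-1, (i.+1 < j)%N -> x i * x j = x j * x i.
Hypothesis xB : forall i j : 'I_n.-1, j = i.+1 :> nat ->
  x i * x j * x i = x j * x i * x j.

Lemma word_eval_eq u v : braid_eq u v -> word_eval u = word_eval v.
Proof.
rewrite /word_eval; elim=> {u v} //=.
- by move=> u v w _ -> _ ->.
- by move=> u u' v v' _ e1 _ e2; rewrite !big_cat /= e1 e2.
- by move=> i [] /=; rewrite !big_cons !big_nil /= mulr1.
- by move=> i j ij; rewrite !big_cons !big_nil /= !mulr1 xC.
- by move=> i j ij; rewrite !big_cons !big_nil /= !mulr1 !mulrA xB.
Qed.

Lemma braid_liftE w : braid_lift (\pi_braid w) = word_eval w.
Proof. exact/word_eval_eq/braid_reprK. Qed.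

Lemma braid_lift1 : braid_lift 1%g = 1.
Proof. by rewrite [LHS]braid_liftE /word_eval big_nil. Qed.

Lemma braid_liftM : {morph braid_lift : g h / (g * h)%g >-> g * h}.
Proof.
move=> u v; elim/braidW: u => u; elim/braidW: v => v.
rewrite [(_ * _)%g]braid_mulE !braid_liftE.
by rewrite /word_eval big_cat.
Qed.

Lemma braid_lift_gen i : braid_lift (braid_gen i) = x i.
Proof. by rewrite braid_liftE /word_eval big_seq1. Qed.

Lemma braid_lift_genV i : braid_lift (braid_gen i)^-1%g = y i.
Proof. by rewrite braid_genV braid_liftE /word_eval big_seq1. Qed.

End Lift.
End BraidGroup.

Section IdealQuotient.
Variables (R : comNzRingType) (A : algType R) (S : set A).

Definition two_sided_ideal (I : set A) : Prop :=
  [/\ I 0, forall x y, I x -> I y -> I (x - y),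
      forall u x, I x -> I (u * x) & forall u x, I x -> I (x * u)].

Definition ideal_gen : set A := smallest two_sided_ideal S.

Lemma ideal_genP : two_sided_ideal ideal_gen.
Proof.
split=> [|x y Ix Iy|u x Ix|u x Ix] I HI; have [[I0 IB Il Ir] SI] := HI.
- exact: I0.
- exact: (IB _ _ (Ix I HI) (Iy I HI)).
- exact: (Il _ _ (Ix I HI)).
- exact: (Ir _ _ (Ix I HI)).
Qed.

Definition ideal_pred : {pred A} := fun x => `[< ideal_gen x >].

Lemma ideal_zmod_closed : zmod_closed ideal_pred.
Proof.
have [I0 IB _ _] := ideal_genP.
by split=> [|x y /asboolP Ix /asboolP Iy]; apply/asboolP; [|exact: IB].
Qed.

HB.instance Definition _ := GRing.isZmodClosed.Build A ideal_pred
  ideal_zmod_closed.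

Definition quotalg : Type := Quotient.quot ideal_pred.
HB.instance Definition _ := GRing.Zmodule.on quotalg.
HB.instance Definition _ := EqQuotient.on quotalg.

Lemma quotalgP (x y : A) :
  (\pi_quotalg x = \pi_quotalg y) <-> ideal_gen (x - y).
Proof.
split=> [/eqP|Ixy]; first by rewrite -Quotient.idealrBE => /asboolP.
by apply/eqP; rewrite -Quotient.idealrBE; apply/asboolP.
Qed.

Lemma quotalgW (P : quotalg -> Prop) :
  (forall x, P (\pi_quotalg x)) -> forall x, P x.
Proof. by move=> Ppi x; rewrite -[x]reprK. Qed.

Lemma quotalg_repr (x : A) : ideal_gen (repr (\pi_quotalg x) - x).
Proof. by apply/quotalgP; rewrite reprK. Qed.

Definition quotalg_mul (x y : quotalg) : quotalg := \pi_quotalg (repr x * repr y).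
Definition quotalg_scale (c : R) (x : quotalg) : quotalg :=
  \pi_quotalg (c *: repr x).

Lemma quotalg_mulE x y :
  quotalg_mul (\pi_quotalg x) (\pi_quotalg y) = \pi_quotalg (x * y).
Proof.
have [I0 IB Il Ir] := ideal_genP; apply/quotalgP.
set x' := repr _; set y' := repr _.
have -> : x' * y' - x * y = x' * (y' - y) - (0 - (x' - x) * y).
  by rewrite mulrBr mulrBl sub0r opprK addrA subrK.
apply: (IB); first exact: (Il _ _ (quotalg_repr _)).
by apply: IB => //; exact: (Ir _ _ (quotalg_repr _)).
Qed.

Lemma quotalg_scaleE c x :
  quotalg_scale c (\pi_quotalg x) = \pi_quotalg (c *: x).
Proof.
have [_ _ Il _] := ideal_genP; apply/quotalgP.
by rewrite -scalerBr -mulr_algl; apply: Il; exact: quotalg_repr.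
Qed.

Lemma quotalg_addE x y :
  \pi_quotalg x + \pi_quotalg y = \pi_quotalg (x + y).
Proof. by apply/esym; exact: (Quotient.pi_add ideal_pred). Qed.

Fact quotalg_mulA : associative quotalg_mul.
Proof.
by move=> x y z; elim/quotalgW: x => x; elim/quotalgW: y => y; elim/quotalgW: z => z;
  rewrite !quotalg_mulE mulrA.
Qed.
Fact quotalg_mul1 : left_id (\pi_quotalg 1) quotalg_mul.
Proof. by move=> x; elim/quotalgW: x => x; rewrite quotalg_mulE mul1r. Qed.
Fact quotalg_mulr1 : right_id (\pi_quotalg 1) quotalg_mul.
Proof. by move=> x; elim/quotalgW: x => x; rewrite quotalg_mulE mulr1. Qed.
Fact quotalg_mulDl : left_distributive quotalg_mul +%R.
Proof.
move=> x y z; elim/quotalgW: x => x; elim/quotalgW: y => y; elim/quotalgW: z => z.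
by rewrite quotalg_addE !quotalg_mulE quotalg_addE mulrDl.
Qed.
Fact quotalg_mulDr : right_distributive quotalg_mul +%R.
Proof.
move=> x y z; elim/quotalgW: x => x; elim/quotalgW: y => y; elim/quotalgW: z => z.
by rewrite quotalg_addE !quotalg_mulE quotalg_addE mulrDr.
Qed.

HB.instance Definition _ := GRing.Zmodule_isPzRing.Build quotalg
  quotalg_mulA quotalg_mul1 quotalg_mulr1 quotalg_mulDl quotalg_mulDr.

Fact quotalg_scaleA c d x :
  quotalg_scale c (quotalg_scale d x) = quotalg_scale (c * d) x.
Proof. by elim/quotalgW: x => x; rewrite !quotalg_scaleE scalerA. Qed.
Fact quotalg_scale1 : left_id 1 quotalg_scale.
Proof. by move=> x; elim/quotalgW: x => x; rewrite quotalg_scaleE scale1r. Qed.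
Fact quotalg_scaleDr : right_distributive quotalg_scale +%R.
Proof.
move=> c x y; elim/quotalgW: x => x; elim/quotalgW: y => y.
by rewrite quotalg_addE !quotalg_scaleE quotalg_addE scalerDr.
Qed.
Fact quotalg_scaleDl x : {morph quotalg_scale^~ x : c d / c + d}.
Proof.
elim/quotalgW: x => x c d.
by rewrite /= !quotalg_scaleE quotalg_addE scalerDl.
Qed.

HB.instance Definition _ := GRing.Zmodule_isLmodule.Build R quotalg
  quotalg_scaleA quotalg_scale1 quotalg_scaleDr quotalg_scaleDl.

Definition quotalg_pi (x : A) : quotalg := \pi_quotalg x.

Fact quotalg_pi_linear : linear quotalg_pi.
Proof. by move=> c x y; rewrite /quotalg_pi -quotalg_addE -quotalg_scaleE. Qed.
Fact quotalg_pi_monoid : monoid_morphism quotalg_pi.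
Proof. by split=> // x y; rewrite /quotalg_pi -quotalg_mulE. Qed.

HB.instance Definition _ := GRing.isLinear.Build R A quotalg _ quotalg_pi
  quotalg_pi_linear.
HB.instance Definition _ := GRing.isMonoidMorphism.Build A quotalg quotalg_pi
  quotalg_pi_monoid.

Lemma quotalg_pi_surj (x : quotalg) : exists y, x = quotalg_pi y.
Proof. by exists (repr x); rewrite /quotalg_pi reprK. Qed.

Lemma quotalg_pi_eq0 x : S x -> quotalg_pi x = 0.
Proof.
move=> Sx; rewrite -[0](raddf0 quotalg_pi); apply/quotalgP.
by rewrite subr0; exact: sub_gen_smallest.
Qed.

Lemma quotalg_scalerAl (c : R) (x y : quotalg) : c *: (x * y) = (c *: x) * y.
Proof.
have [[u ->] [v ->]] := (quotalg_pi_surj x, quotalg_pi_surj y).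
by rewrite -rmorphM -!linearZ /= -rmorphM scalerAl.
Qed.

Lemma quotalg_scalerAr (c : R) (x y : quotalg) : c *: (x * y) = x * (c *: y).
Proof.
have [[u ->] [v ->]] := (quotalg_pi_surj x, quotalg_pi_surj y).
by rewrite -rmorphM -!linearZ /= -rmorphM scalerAr.
Qed.

Section Lift.
Variables (B : algType R) (f : A -> B).
Hypotheses (f_linear : linear f) (f_monoid : monoid_morphism f).
Hypothesis f_S : forall x, S x -> f x = 0.

Definition quotalg_lift (x : quotalg) : B := f (repr x).

Let fB x y : f (x - y) = f x - f y.
Proof. by rewrite addrC -scaleN1r f_linear scaleN1r addrC. Qed.

Lemma quotalg_liftE x : quotalg_lift (quotalg_pi x) = f x.
Proof.
have f0 : f 0 = 0 by rewrite -[0 in LHS](subrr 0) fB subrr.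
have ker : two_sided_ideal [set z | f z = 0].
  split=> //= [u v fu fv|u v fv|u v fv].
  - by rewrite fB fu fv subrr.
  - by rewrite f_monoid.2 fv mulr0.
  - by rewrite f_monoid.2 fv mul0r.
apply/eqP; rewrite -subr_eq0 /quotalg_lift -fB; apply/eqP.
exact: (quotalg_repr x (conj ker f_S)).
Qed.

Lemma quotalg_lift_linear : linear quotalg_lift.
Proof.
move=> c x y; have [[u ->] [v ->]] := (quotalg_pi_surj x, quotalg_pi_surj y).
by rewrite -linearP !quotalg_liftE f_linear.
Qed.

Lemma quotalg_lift_monoid : monoid_morphism quotalg_lift.
Proof.
split=> [|x y]; first by rewrite [LHS]quotalg_liftE f_monoid.1.
have [[u ->] [v ->]] := (quotalg_pi_surj x, quotalg_pi_surj y).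
by rewrite -rmorphM !quotalg_liftE f_monoid.2.
Qed.

End Lift.
End IdealQuotient.

(* The defining relations of Q_n only need a unit a and elements b, c of a      *)
(* commutative ring; Zabc below is the intended ring Z[a^+-1, b^+-1, c^+-1].   *)
Record coeff := Coeff {
  coeff_ring :> comUnitRingType;
  pa : coeff_ring;
  pb : coeff_ring;
  pc : coeff_ring;
  pa_unit : pa \is a GRing.unit
}.

Notation RB P n := (galg (coeff_ring P) (braid n)).

(* The two defining relations, written as elements which are to vanish; t1 and *)
(* t2 stand for the inverses of s1 and s2.                                     *)
Section Relators.
Variables (R : comUnitRingType) (a b c : R) (A : algType R).

Definition cubic_relator (s1 : A) : A :=
  (s1 - a%:A) * (s1 - b%:A) * (s1 - c%:A).

Definition Q_relator (s1 s2 t1 t2 : A) : A :=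
  t1 * s2 * s1
  - (s1 * s2 * t1 - a^-1 *: (s1 * s2) + a *: (s1 * t2) + a *: (t1 * s2)
     - a ^+ 3 *: (t1 * t2) + a^-1 *: (s2 * s1) - a *: (s2 * t1)
     - a *: (t2 * s1) + a ^+ 3 *: (t2 * t1) + a ^+ 2 *: (t1 * t2 * s1)
     - a ^+ 2 *: (s1 * t2 * t1)).

End Relators.

Lemma cubic_relator_morph (R : comUnitRingType) (a b c : R) (A B : algType R)
    (f : {lrmorphism A -> B}) (s1 : A) :
  f (cubic_relator a b c s1) = cubic_relator a b c (f s1).
Proof. by rewrite /cubic_relator !rmorphM !raddfB /= !linearZ /= !rmorph1. Qed.

Lemma Q_relator_morph (R : comUnitRingType) (a : R) (A B : algType R)
    (f : {lrmorphism A -> B}) (s1 s2 t1 t2 : A) :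
  f (Q_relator a s1 s2 t1 t2) = Q_relator a (f s1) (f s2) (f t1) (f t2).
Proof. by rewrite /Q_relator !(raddfB, raddfD) /= !linearZ /= !rmorphM. Qed.

Lemma cubic_relator_eps (R : comUnitRingType) (a b c : R) :
  cubic_relator a b c (a : R^o) = 0.
Proof. by rewrite /cubic_relator /GRing.scale /= mulr1 subrr !mul0r. Qed.

Lemma Q_relator_eps (R : comUnitRingType) (a : R) : a \is a GRing.unit ->
  @Q_relator R a R^o a a a^-1 a^-1 = 0.
Proof.
move=> ua; rewrite /Q_relator /GRing.scale /=.
have h : a * a^-1 = 1 by exact: divrr.
move: (a^-1) h => y h.
ring: h.
Qed.

Definition Q_relators (P : coeff) (n : nat) : set (RB P n) :=
  [set cubic_relator (pa P) (pb P) (pc P) (gdelta P (braid_gen i))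
    | i in [set i : 'I_n.-1 | i = 0 :> nat]] `|`
  [set Q_relator (pa P) (gdelta P (braid_gen ij.1))
                    (gdelta P (braid_gen ij.2))
                    (gdelta P (braid_gen ij.1)^-1%g)
                    (gdelta P (braid_gen ij.2)^-1%g)
    | ij in [set ij : 'I_n.-1 * 'I_n.-1 | ij.1 = 0 :> nat /\ ij.2 = 1 :> nat]].

(* Q_n, meaningful for 3 <= n. *)
Definition Q (P : coeff) (n : nat) : Type := quotalg (@Q_relators P n).

HB.instance Definition _ (P : coeff) n := GRing.PzRing.on (Q P n).
HB.instance Definition _ (P : coeff) n := GRing.Lmodule.on (Q P n).

Definition Q_pi (P : coeff) n (x : RB P n) : Q P n := quotalg_pi (@Q_relators P n) x.

Section QLift.
Variables (P : coeff) (n : nat) (A : algType P) (x y : 'I_n.-1 -> A).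

Definition Q_lift : Q P n -> A :=
  quotalg_lift (galg_lin (braid_lift x y) : RB P n -> A).

Hypotheses (xy : forall i, x i * y i = 1) (yx : forall i, y i * x i = 1).
Hypothesis xC : forall i j : 'I_n.-1, (i.+1 < j)%N -> x i * x j = x j * x i.
Hypothesis xB : forall i j : 'I_n.-1, j = i.+1 :> nat ->
  x i * x j * x i = x j * x i * x j.
Hypothesis x_cubic : forall i : 'I_n.-1, i = 0 :> nat ->
  cubic_relator (pa P) (pb P) (pc P) (x i) = 0.
Hypothesis x_Q : forall i j : 'I_n.-1, i = 0 :> nat -> j = 1 :> nat ->
  Q_relator (pa P) (x i) (x j) (y i) (y j) = 0.

Let f : RB P n -> A := galg_lin (braid_lift x y).

Let f_linear : linear f. Proof. exact: galg_linP. Qed.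

Let f_monoid : monoid_morphism f.
Proof. by apply: galg_lift_monoid; [exact: braid_lift1|exact: braid_liftM]. Qed.

HB.instance Definition _ := GRing.isLinear.Build _ _ _ _ f f_linear.
HB.instance Definition _ := GRing.isMonoidMorphism.Build _ _ f f_monoid.

Let fgen i : f (gdelta P (braid_gen i)) = x i.
Proof. by rewrite /f galg_linU scale1r braid_lift_gen. Qed.

Let fgenV i : f (gdelta P (braid_gen i)^-1%g) = y i.
Proof. by rewrite /f galg_linU scale1r braid_lift_genV. Qed.

Let f_rel z : @Q_relators P n z -> f z = 0.
Proof.
case=> [[i i0 <-]|[[i j] [i0 j1] <-]].
  by rewrite cubic_relator_morph [X in cubic_relator _ _ _ X]fgen; exact: x_cubic.
rewrite Q_relator_morph [X in Q_relator _ X]fgen [X in Q_relator _ _ X]fgen.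
rewrite [X in Q_relator _ _ _ X]fgenV [X in Q_relator _ _ _ _ X]fgenV.
exact: x_Q.
Qed.

Lemma Q_liftE z : Q_lift (Q_pi z) = f z.
Proof. exact: quotalg_liftE. Qed.

Lemma Q_lift_gen i : Q_lift (Q_pi (gdelta P (braid_gen i))) = x i.
Proof. by rewrite Q_liftE fgen. Qed.

Lemma Q_lift_linear : linear Q_lift.
Proof. exact: quotalg_lift_linear. Qed.

Lemma Q_lift_monoid : monoid_morphism Q_lift.
Proof. exact: quotalg_lift_monoid. Qed.

End QLift.

(* The morphism Q_n -> R induced by s_i |-> a. *)
Definition Q_eps (P : coeff) (n : nat) : Q P n -> P^o :=
  @Q_lift P n P^o (fun _ => pa P : P^o) (fun _ => (pa P)^-1 : P^o).


Fact Q_eps_linear (P : coeff) n : linear (@Q_eps P n).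
Proof.
apply: Q_lift_linear => [i|i|i j _|i j _|i _|i j _ _].
- exact: divrr (pa_unit P).
- exact: mulVr (pa_unit P).
- by [].
- by [].
- exact: cubic_relator_eps.
- exact: Q_relator_eps (pa_unit P).
Qed.

Fact Q_eps_monoid (P : coeff) n : monoid_morphism (@Q_eps P n).
Proof.
apply: Q_lift_monoid => [i|i|i j _|i j _|i _|i j _ _].
- exact: divrr (pa_unit P).
- exact: mulVr (pa_unit P).
- by [].
- by [].
- exact: cubic_relator_eps.
- exact: Q_relator_eps (pa_unit P).
Qed.

Fact Q_nz (P : coeff) n : 1 != 0 :> Q P n.
Proof.
apply/eqP => /(congr1 (@Q_eps P n)); rewrite (@Q_eps_monoid P n).1 => e.
have := @Q_eps_linear P n 1 0 0; rewrite !scale1r addr0 -e => /eqP.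
by rewrite -[X in X == _]addr0 (inj_eq (addrI 1)) eq_sym oner_eq0.
Qed.

HB.instance Definition _ (P : coeff) n := GRing.PzSemiRing_isNonZero.Build (Q P n) (@Q_nz P n).
HB.instance Definition _ (P : coeff) n := GRing.Lmodule_isLalgebra.Build P (Q P n)
  (@quotalg_scalerAl _ _ (@Q_relators P n)).
HB.instance Definition _ (P : coeff) n := GRing.Lalgebra_isAlgebra.Build P (Q P n)
  (@quotalg_scalerAr _ _ (@Q_relators P n)).

HB.instance Definition _ (P : coeff) n := GRing.isLinear.Build P (Q P n) P^o _
  (@Q_eps P n) (@Q_eps_linear P n).
HB.instance Definition _ (P : coeff) n := GRing.isMonoidMorphism.Build (Q P n) P^o
  (@Q_eps P n) (@Q_eps_monoid P n).

HB.instance Definition _ (P : coeff) n := GRing.isLinear.Build P (RB P n)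
  (Q P n) _ (@Q_pi P n) (@quotalg_pi_linear _ _ (@Q_relators P n)).
HB.instance Definition _ (P : coeff) n := GRing.isMonoidMorphism.Build (RB P n)
  (Q P n) (@Q_pi P n) (@quotalg_pi_monoid _ _ (@Q_relators P n)).

Definition Q_gen (P : coeff) n (i : 'I_n.-1) : Q P n := Q_pi (gdelta P (braid_gen i)).
Definition Q_genV (P : coeff) n (i : 'I_n.-1) : Q P n :=
  Q_pi (gdelta P (braid_gen i)^-1%g).

Fact Q_piM (P : coeff) n (g h : braid n) :
  Q_pi (gdelta P (g * h)%g) = Q_pi (gdelta P g) * Q_pi (gdelta P h).
Proof. by rewrite gdeltaM rmorphM. Qed.

Lemma Q_genVK (P : coeff) n i : @Q_gen P n i * Q_genV P i = 1.
Proof. by rewrite -rmorphM -gdeltaM mulgV rmorph1. Qed.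

Lemma Q_genKV (P : coeff) n i : @Q_genV P n i * Q_gen P i = 1.
Proof. by rewrite -rmorphM -gdeltaM mulVg rmorph1. Qed.

Lemma Q_gen_comm (P : coeff) n (i j : 'I_n.-1) : (i.+1 < j)%N ->
  Q_gen P i * Q_gen P j = Q_gen P j * Q_gen P i.
Proof.
move=> ij; rewrite /Q_gen -!Q_piM; congr (Q_pi (gdelta _ _)).
by rewrite [LHS]braid_mulE [RHS]braid_mulE; apply/braidP; exact: braid_comm.
Qed.

Lemma Q_gen_artin (P : coeff) n (i j : 'I_n.-1) : j = i.+1 :> nat ->
  Q_gen P i * Q_gen P j * Q_gen P i = Q_gen P j * Q_gen P i * Q_gen P j.
Proof.
move=> ij; rewrite /Q_gen -!Q_piM; congr (Q_pi (gdelta _ _)).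
rewrite [(braid_gen i * braid_gen j)%g]braid_mulE [LHS]braid_mulE.
rewrite [(braid_gen j * braid_gen i)%g]braid_mulE [RHS]braid_mulE.
by apply/braidP; exact: braid_artin.
Qed.

Lemma Q_gen_cubic (P : coeff) n (i : 'I_n.-1) : i = 0 :> nat ->
  cubic_relator (pa P) (pb P) (pc P) (Q_gen P i) = 0.
Proof.
move=> i0; rewrite -cubic_relator_morph.
by apply: quotalg_pi_eq0; left; exists i.
Qed.

Lemma Q_gen_rel (P : coeff) n (i j : 'I_n.-1) : i = 0 :> nat -> j = 1 :> nat ->
  Q_relator (pa P) (Q_gen P i) (Q_gen P j) (Q_genV P i) (Q_genV P j) = 0.
Proof.
move=> i0 j1; rewrite -Q_relator_morph.
by apply: quotalg_pi_eq0; right; exists (i, j).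
Qed.

Lemma Q_eps_gen (P : coeff) n i : Q_eps (@Q_gen P n i) = pa P.
Proof.
apply: Q_lift_gen => [k|k|k l _|k l _|k _|k l _ _].
- exact: divrr (pa_unit P).
- exact: mulVr (pa_unit P).
- by [].
- by [].
- exact: cubic_relator_eps.
- exact: Q_relator_eps (pa_unit P).
Qed.

(* The natural morphism Q_n -> Q_{n+1}, s_i |-> s_i. *)
Definition Q_widen_ord n : 'I_n.-1 -> 'I_n.+1.-1 := widen_ord (leq_pred n).

Definition Q_nat (P : coeff) n : Q P n -> Q P n.+1 :=
  Q_lift (fun i => Q_gen P (@Q_widen_ord n i)) (fun i => Q_genV P (@Q_widen_ord n i)).

Section QNat.
Variables (P : coeff) (n : nat).
Fact Q_nat_linear : linear (@Q_nat P n).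
Proof.
apply: Q_lift_linear => [i|i|i j ij|i j ij|i i0|i j i0 j1].
- exact: Q_genVK.
- exact: Q_genKV.
- exact: Q_gen_comm.
- exact: Q_gen_artin.
- exact: Q_gen_cubic.
- exact: Q_gen_rel.
Qed.

Fact Q_nat_monoid : monoid_morphism (@Q_nat P n).
Proof.
apply: Q_lift_monoid => [i|i|i j ij|i j ij|i i0|i j i0 j1].
- exact: Q_genVK.
- exact: Q_genKV.
- exact: Q_gen_comm.
- exact: Q_gen_artin.
- exact: Q_gen_cubic.
- exact: Q_gen_rel.
Qed.

Lemma Q_nat_gen i : Q_nat (@Q_gen P n i) = Q_gen P (Q_widen_ord i).
Proof.
apply: Q_lift_gen => [k|k|k l kl|k l kl|k k0|k l k0 l1].
- exact: Q_genVK.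
- exact: Q_genKV.
- exact: Q_gen_comm.
- exact: Q_gen_artin.
- exact: Q_gen_cubic.
- exact: Q_gen_rel.
Qed.

HB.instance Definition _ := GRing.isLinear.Build P (Q P n) (Q P n.+1) _
  (@Q_nat P n) Q_nat_linear.
HB.instance Definition _ := GRing.isMonoidMorphism.Build (Q P n) (Q P n.+1)
  (@Q_nat P n) Q_nat_monoid.

End QNat.

Section Span.
Variables (R : nzRingType) (V : lmodType R).

Definition submodule (M : set V) : Prop :=
  M 0 /\ forall (r : R) x y, M x -> M y -> M (r *: x + y).

Definition Rspan (X : set V) : set V := smallest submodule X.

Definition congr_mod (M : set V) (x y : V) : Prop := M (x - y).

End Span.

Section QuotientFive.
Variable P : coeff.

Definition Q45 : {lrmorphism Q P 4 -> Q P 5} := @Q_nat P 4.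

Definition eps4 : {lrmorphism Q P 4 -> P^o} := @Q_eps P 4.

(* s1V, ..., s4V are the inverses of s1, ..., s4. *)
Definition s1 : Q P 5 := @Q_gen P 5 (@Ordinal 4 0 isT).
Definition s2 : Q P 5 := @Q_gen P 5 (@Ordinal 4 1 isT).
Definition s3 : Q P 5 := @Q_gen P 5 (@Ordinal 4 2 isT).
Definition s4 : Q P 5 := @Q_gen P 5 (@Ordinal 4 3 isT).
Definition s1V : Q P 5 := @Q_genV P 5 (@Ordinal 4 0 isT).
Definition s2V : Q P 5 := @Q_genV P 5 (@Ordinal 4 1 isT).
Definition s3V : Q P 5 := @Q_genV P 5 (@Ordinal 4 2 isT).
Definition s4V : Q P 5 := @Q_genV P 5 (@Ordinal 4 3 isT).

Definition w_plus : Q P 5 := s3 * s2 * s1V * s2 * s3.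
Definition w_minus : Q P 5 := s3V * s2V * s1 * s2V * s3V.

Definition u4 : set (Q P 5) :=
  [set x | exists r t t' : P, x = r%:A + t *: s4 + t' *: s4V].

(* Q_4 u_4 Q_4 u_4 Q_4. *)
Definition Q5_2 : set (Q P 5) :=
  Rspan [set x | exists (p q r : Q P 4) (u v : Q P 5),
    [/\ u4 u, u4 v & x = Q45 p * u * Q45 q * v * Q45 r]].

Definition Q4_subbimodule (M : set (Q P 5)) : Prop :=
  submodule M /\ forall (q : Q P 4) x, M x -> M (Q45 q * x) /\ M (x * Q45 q).

(* Q_5^(1.5). *)
Definition Q5_15 : set (Q P 5) :=
  smallest Q4_subbimodule
    [set 1; s4; s4V; s4 * s3V * s4; s4 * s3 * s2V * s3 * s4;
         s4V * s3V * s2 * s3V * s4V].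

End QuotientFive.

Arguments Q45 {P}.
Arguments eps4 {P}.
Arguments s1 {P}.
Arguments s2 {P}.
Arguments s3 {P}.
Arguments s4 {P}.
Arguments s1V {P}.
Arguments s2V {P}.
Arguments s3V {P}.
Arguments s4V {P}.
Arguments w_plus {P}.
Arguments w_minus {P}.
Arguments u4 {P}.
Arguments Q5_2 P : clear implicits.
Arguments Q5_15 P : clear implicits.

(* The multiplicative copy of an additive group. *)
Definition mulof (V : zmodType) : Type := V.

HB.instance Definition _ (V : zmodType) := Choice.copy (mulof V) V.
HB.instance Definition _ (V : zmodType) := isGroup.Build (mulof V)
  (@addrA V) (@add0r V) (@addr0 V) (@addNr V) (@addrN V).

Lemma mulofC (V : zmodType) (u v : mulof V) : (u * v = v * u)%g.
Proof. exact: (@addrC V). Qed.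

(* R = Z[a^+-1, b^+-1, c^+-1] is the group ring of Z^3, the exponent (i, j, k) *)
(* standing for the monomial a^i b^j c^k.                                      *)
Definition laurent : Type := galg int (mulof (int * int * int)%type).

HB.instance Definition _ := GRing.NzRing.on laurent.

Lemma laurent_mulC : @commutative laurent laurent *%R.
Proof.
move=> x y; change (galg_mul x y = galg_mul y x).
rewrite /galg_mul exchange_big; apply: eq_bigr => k _; apply: eq_bigr => l _.
by rewrite mulofC [x@_l * _]mulrC.
Qed.

HB.instance Definition _ :=
  GRing.PzRing_hasCommutativeMul.Build laurent laurent_mulC.

Section LaurentUnits.
Implicit Types x y : laurent.

Definition laurent_unit : {pred laurent} := fun x => `[< exists y, y * x = 1 >].

Definition laurent_inv x : laurent :=
  if pselect (exists y, y * x = 1) is left ex then sval (cid ex) else x.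

Lemma laurent_mulVx : {in laurent_unit, left_inverse 1 laurent_inv *%R}.
Proof.
move=> x /asboolP ex; rewrite /laurent_inv; case: pselect => // ex'.
by case: cid.
Qed.

Lemma laurent_unitPl x y : y * x = 1 -> laurent_unit x.
Proof. by move=> yx; apply/asboolP; exists y. Qed.

Lemma laurent_inv_out : {in [predC laurent_unit], laurent_inv =1 id}.
Proof.
move=> x; rewrite inE => /asboolP nex; rewrite /laurent_inv.
by case: pselect.
Qed.

HB.instance Definition _ := GRing.ComNzRing_hasMulInverse.Build laurent
  laurent_mulVx laurent_unitPl laurent_inv_out.

End LaurentUnits.

HB.lock Definition lmon (i j k : int) : laurent :=
  gdelta int ((i, j, k) : mulof (int * int * int)%type).

Notation la := (lmon 1 0 0).
Notation lb := (lmon 0 1 0).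
Notation lc := (lmon 0 0 1).

Lemma lmonM i j k i' j' k' :
  lmon i j k * lmon i' j' k' = lmon (i + i') (j + j') (k + k').
Proof. by rewrite unlock -gdeltaM. Qed.

Lemma lmon0 : lmon 0 0 0 = 1.
Proof. by rewrite unlock. Qed.

Lemma lmon_unit i j k : lmon i j k \is a GRing.unit.
Proof.
by apply/unitrPr; exists (lmon (- i) (- j) (- k)); rewrite lmonM !addrN lmon0.
Qed.

Lemma lmon_inv i j k : (lmon i j k)^-1 = lmon (- i) (- j) (- k).
Proof.
apply: (mulrI (lmon_unit i j k)).
by rewrite lmonM !addrN lmon0 divrr // lmon_unit.
Qed.

Lemma la_unit : la \is a GRing.unit.
Proof. exact: lmon_unit. Qed.

Definition Zabc : coeff := @Coeff laurent la lb lc la_unit.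

(* Main.v *)
(* Write t_i for the inverse of s_i, u_i for the span of 1, s_i, t_i, Q_3
   for the algebra generated by s_1 and s_2, and z = s_2 t_1 s_2.
   Multiplying the defining relation by s_2 on the right gives s_1 z = a z
   modulo u_1 u_2 u_1, whence Q_3 = u_1 u_2 u_1 + R z and, with the cubic
   relation, t_2 s_1 t_2 = (a/abc) z modulo u_1 u_2 u_1. Let L be the
   Q_3-subbimodule generated by 1, s_3, t_3 and s_3 t_2 s_3. Braid moves
   give s_3 Q_3 t_3 and t_3 Q_3 s_3 inside L, and w_+ = s_3 z s_3, w_-
   satisfy s_i w = w s_i = a w modulo L for i = 1, 2: for i = 1 by the
   property of z, and for i = 2 since s_2 commutes with w and is a conjugate
   of s_1. Hence L + R w_+ + R w_- is stable under s_3, that is, it is Q_4.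

   One strand up, Q_5^(1.5) plays the part of L. Sliding s_4 through the
   generators of L and through w_+, w_- proves (1), and computing s_4 x s_4
   for the same x proves the spanning statement in (2). In the congruences,
   s_1 and s_2 are inherited from Q_4; s_3 commutes with s_4 w_+ s_4 and is
   a conjugate of s_2; and for s_4 w_- s_4 one applies the relation between
   s_3 and s_4 to s_3 s_4 t_3 s_4, keeping track of which words occur in the
   remainder.

   Each one-sided computation is done once: the relations are preserved by
   passing to the converse algebra, and by exchanging s_i with t_i and a, b,
   c with their inverses. *)
From HB Require Import structures.
Require Import Defs.
From mathcomp Require Import all_boot all_order all_algebra.
From mathcomp Require Import boolp classical_sets finmap monalg ring.

Set Implicit Arguments.
Unset Strict Implicit.
Unset Printing Implicit Defensive.

Import GRing.Theory.
Local Open Scope ring_scope.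
Local Open Scope classical_set_scope.

(** * Submodules and linear combinations *)

Section Submodule.
Variables (R : nzRingType) (V : lmodType R) (D : set V).
Hypothesis D_sub : submodule D.

Lemma subm0 : D 0. Proof. by case: D_sub. Qed.
Lemma submD u v : D u -> D v -> D (u + v).
Proof. by move=> Du Dv; rewrite -[u]scale1r; apply: D_sub.2. Qed.
Lemma submZ r u : D u -> D (r *: u).
Proof. by move=> Du; rewrite -[_ *: u]addr0; apply: D_sub.2 => //;
  exact: subm0. Qed.
Lemma submN u : D u -> D (- u).
Proof. by rewrite -scaleN1r; exact: submZ. Qed.
Lemma submB u v : D u -> D v -> D (u - v).
Proof. by move=> Du /submN; exact: submD. Qed.
Lemma submDr u v : D (u + v) -> D v -> D u.
Proof. by move=> Duv Dv; rewrite -(addrK v u); exact: submB. Qed.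
Lemma submBr u v : D (u - v) -> D v -> D u.
Proof. by move=> Duv Dv; rewrite -(subrK v u); exact: submD. Qed.
Lemma submBC u v : D (u - v) -> D (v - u).
Proof. by move/submN; rewrite opprB. Qed.
Lemma submBT u v w : D (u - v) -> D (v - w) -> D (u - w).
Proof. by move=> uv vw; rewrite -(subrKA v); exact: submD. Qed.
Lemma submBZ r u v : D (u - v) -> D (r *: u - r *: v).
Proof. by move=> uv; rewrite -scalerBr; exact: submZ. Qed.

End Submodule.

(** The [ring] tactic applies to the scalars but not to a noncommutative algebra, so linear
    combinations are reified over a list of atoms and [ring] only sees their coefficients. *)
Inductive lexp (R : Type) : Type :=
| LAdd of lexp R & lexp R
| LOpp of lexp R
| LScale of R & lexp R
| LAtom of nat.
Arguments LAtom {R}.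

Section LinearReflection.
Variables (R : nzRingType) (V : lmodType R).

Fixpoint lexp_eval (vs : seq V) (e : lexp R) : V :=
  match e with
  | LAdd e1 e2 => lexp_eval vs e1 + lexp_eval vs e2
  | LOpp e1 => - lexp_eval vs e1
  | LScale r e1 => r *: lexp_eval vs e1
  | LAtom i => nth 0 vs i
  end.

Fixpoint lexp_coef (i : nat) (e : lexp R) : R :=
  match e with
  | LAdd e1 e2 => lexp_coef i e1 + lexp_coef i e2
  | LOpp e1 => - lexp_coef i e1
  | LScale r e1 => r * lexp_coef i e1
  | LAtom j => if eqn i j then 1 else 0
  end.

Lemma lexp_evalE vs e :
  lexp_eval vs e = \sum_(i < size vs) lexp_coef i e *: vs`_i.
Proof.
elim: e => [e1 IH1 e2 IH2|e1 IH1|r e1 IH1|j] /=.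
- by rewrite IH1 IH2 -big_split; apply: eq_bigr => i _; rewrite scalerDl.
- by rewrite IH1 -sumrN; apply: eq_bigr => i _; rewrite scaleNr.
- by rewrite IH1 scaler_sumr; apply: eq_bigr => i _; rewrite scalerA.
have [lt_j|le_j] := ltnP j (size vs); last first.
  rewrite nth_default // big1 // => i _.
  by rewrite -[eqn _ _]/(i == j :> nat) ltn_eqF ?scale0r // (leq_trans _ le_j).
rewrite (bigD1 (Ordinal lt_j)) //= -[eqn j j]/(j == j) eqxx scale1r.
rewrite big1 ?addr0 // => i; rewrite -val_eqE /= => /negPf.
by rewrite -[eqn _ _]/(i == j :> nat) => ->; rewrite scale0r.
Qed.

(** [i] is the index of the head of [vs] in the whole list of atoms, to which the coefficients
    refer. *)
Fixpoint lexp_all (e : lexp R) (D : set V) (i : nat) (vs : seq V) : Prop :=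
  if vs is v :: vs' then
    (D v \/ lexp_coef i e = 0) /\ lexp_all e D i.+1 vs'
  else True.

Lemma lexp_mem (D : set V) vs e :
  submodule D -> lexp_all e D 0 vs -> D (lexp_eval vs e).
Proof.
move=> Ds; rewrite lexp_evalE => all_vs.
have step k : lexp_all e D k vs ->
    D (\sum_(i < size vs) lexp_coef (k + i) e *: vs`_i).
  elim: vs k {all_vs} => [|v vs IH] k /=.
    by move=> _; rewrite big_ord0; exact: subm0.
  case=> De all_vs; rewrite big_ord_recl /= addn0; apply: submD => //.
    case: De => [Dv|->]; first exact: submZ.
    by rewrite scale0r; exact: subm0.
  under eq_bigr do rewrite /bump /= add1n addnS -addSn.
  exact: IH.
exact: (step 0%N).
Qed.

End LinearReflection.

(** The [match goal] runs [unify] while the index is being computed, and its failure passes on to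
    the next atom. *)
Ltac lexp_find v vs :=
  match vs with
  | ?w :: _ => let _ := match goal with _ => unify v w end in constr:(0%N)
  | _ :: ?vs' => let i := lexp_find v vs' in constr:(S i)
  end.

Ltac lexp_atoms t vs :=
  match t with
  | (?u + ?v)%R => let vs := lexp_atoms u vs in lexp_atoms v vs
  | (- ?u)%R => lexp_atoms u vs
  | (?r *: ?u)%R => lexp_atoms u vs
  | _ => match vs with
         | _ => let _ := lexp_find t vs in vs
         | _ => constr:(t :: vs)
         end
  end.

Ltac lexp_reify R t vs :=
  match t with
  | (?u + ?v)%R =>
      let e1 := lexp_reify R u vs in let e2 := lexp_reify R v vs in
      constr:(@LAdd R e1 e2)
  | (- ?u)%R => let e1 := lexp_reify R u vs in constr:(@LOpp R e1)
  | (?r *: ?u)%R => let e1 := lexp_reify R u vs in constr:(@LScale R r e1)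
  | _ => let i := lexp_find t vs in constr:(@LAtom R i)
  end.

(* Reduces [D t], for a submodule [D] and a linear combination [t], to [D v]
   for the atoms [v] of [t] whose total coefficient [tac] fails to prove zero. *)
Ltac lin_mem_by Ds tac :=
  match goal with
  | |- ?D ?t =>
    match type of Ds with
    | @submodule ?R ?V _ =>
      let vs := lexp_atoms t (@nil V) in
      let e := lexp_reify R t vs in
      apply: (@lexp_mem R V D vs e Ds); cbn [lexp_all lexp_coef eqn];
      repeat (split; [first [by left | by right; tac | left]|]); try exact I
    end
  end.

Ltac lin_mem Ds := lin_mem_by Ds ltac:(ring).

(** An equality becomes a membership in the zero submodule, so that [lin_eq] reuses [lin_mem_by]. *)
Lemma subm_eq0 (R : nzRingType) (V : lmodType R) : submodule [set u : V
  | u = 0].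
Proof. by split=> // r u v /= -> ->; rewrite scaler0 addr0. Qed.

Ltac lin_eq_by tac :=
  apply/eqP; rewrite -subr_eq0; apply/eqP;
  match goal with
  | |- @eq ?V ?t _ =>
    change ([set u : V | u = 0] t); lin_mem_by (subm_eq0 V) tac; try by []
  end.
Ltac lin_eq := lin_eq_by ltac:(ring).

Section Closure.
Variables (R : comNzRingType) (A : algType R).
Implicit Types (D : set A) (x p q : A).

Definition lclosed x D := forall d, D d -> D (x * d).
Definition rclosed x D := forall d, D d -> D (d * x).
Definition biclosed x D := lclosed x D /\ rclosed x D.

(** Pulling [D] back along [d |-> p d q] lets a lemma on arbitrary submodules be applied inside a
    longer product. *)
Lemma subm_sandwich D p q : submodule D -> submodule [set d | D (p * d * q)].
Proof.
move=> Ds; split; first by rewrite /= mulr0 mul0r; exact: subm0.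
move=> r u v /= Du Dv.
by rewrite mulrDr mulrDl -scalerAr -scalerAl; apply: Ds.2.
Qed.

End Closure.

Ltac expand :=
  rewrite ?(mulrDl, mulrDr, mulNr, mulrN) -?(scalerAl, scalerAr)
    ?(mulr1, mul1r, mulrA).

(** * Consequences of the cubic relation and of the braid relation *)

Section Cubic.
Variables (R : comUnitRingType) (a b c : R) (A : algType R).
Hypotheses (ua : a \is a GRing.unit) (ub : b \is a GRing.unit)
  (uc : c \is a GRing.unit).
Implicit Types (x X y Y p q : A) (D : set A).

Notation dl := (a * b * c).

Lemma dl_unit : dl \is a GRing.unit.
Proof. by rewrite !unitrM ua ub uc. Qed.

(* [X], [Y], [V] are the inverses of [x], [y], [v], and [t1], ..., [t4] those of
   [s1], ..., [s4]. *)
Record cubic x X : Prop := Cubic {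
  cubicVr : x * X = 1;
  cubicVl : X * x = 1;
  cubic_eq0 : cubic_relator a b c x = 0 }.

Section CubicInverse.
Variables (x X : A).
Hypothesis xX : cubic x X.

(** Multiplying the cubic relation by [X] gives [x^2 = (a + b + c) x - (ab + bc + ca) + abc X]. *)
Lemma cubic_sqr D : submodule D -> D 1 -> D x -> D (x * x - dl *: X).
Proof.
move=> Ds D1 Dx; have [xK _ e] := xX.
have xKr p : p * x * X = p by rewrite -mulrA xK mulr1.
have De : cubic_relator a b c x * X = 0 by rewrite e mul0r.
rewrite -[_ - _]subr0 -De /cubic_relator.
expand; rewrite ?xKr ?xK; lin_mem Ds.
Qed.

Lemma cubic_sqr_mem D : submodule D -> D 1 -> D x -> D X -> D (x * x).
Proof.
move=> Ds D1 Dx DX; apply: (submBr Ds (cubic_sqr Ds D1 Dx)); exact: submZ.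
Qed.

Lemma cubic_inv_mem D : submodule D -> D 1 -> D x -> D (x * x) -> D X.
Proof.
move=> Ds D1 Dx Dxx; rewrite -[X]scale1r -(mulVr dl_unit) -scalerA;
  apply: submZ => //.
exact: (submBr Ds (submBC Ds (cubic_sqr Ds D1 Dx)) Dxx).
Qed.

(** [X] is a quadratic polynomial in [x]; [cubic_inv_mem] is applied to the submodule of all [e]
    with [e d] in [D]. *)
Lemma lclosedV D : submodule D -> lclosed x D -> lclosed X D.
Proof.
move=> Ds Dx d Dd; have := cubic_inv_mem (subm_sandwich 1 d Ds).
rewrite /= !mul1r -mulrA; apply=> //; first exact: Dx.
exact: Dx _ (Dx _ Dd).
Qed.

Lemma rclosedV D : submodule D -> rclosed x D -> rclosed X D.
Proof.
move=> Ds Dx d Dd; have := cubic_inv_mem (subm_sandwich d 1 Ds).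
rewrite /= !mulr1 mulrA; apply=> //; first exact: Dx.
exact: Dx _ (Dx _ Dd).
Qed.

End CubicInverse.

Section Braided.
Variables x X y Y : A.
Hypotheses (xK : x * X = 1) (Xx : X * x = 1) (yK : y * Y = 1) (Yy : Y * y = 1).
Hypothesis xyx : x * y * x = y * x * y.

Lemma canc p u v : u * v = 1 -> p * u * v = p.
Proof. by move=> uv; rewrite -mulrA uv mulr1. Qed.

Let xKp p := canc p xK.
Let Xxp p := canc p Xx.
Let yKp p := canc p yK.
Let Yyp p := canc p Yy.

(** From here to [braid6]: the braid relation with some letters inverted. The prefix [p] allows
    rewriting in the middle of a left-associated product. *)
Lemma braid1 p : p * x * y * x = p * y * x * y.
Proof. by rewrite -!mulrA [x * _]mulrA xyx !mulrA. Qed.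

Lemma braid2 p : p * x * y * X = p * Y * x * y.
Proof. by rewrite -[in LHS](Yyp p) -braid1 xKp. Qed.

Lemma braid3 p : p * X * y * x = p * y * x * Y.
Proof. by rewrite -[in RHS](Xxp p) braid1 yKp. Qed.

Lemma braid4 p : p * x * Y * X = p * Y * X * y.
Proof. by rewrite -[in LHS](Yyp p) -braid3 xKp. Qed.

Lemma braid5 p : p * X * Y * x = p * y * X * Y.
Proof. by rewrite -[LHS]yKp -braid2 Xxp. Qed.

Lemma braid6 p : p * X * Y * X = p * Y * X * Y.
Proof. by rewrite -[in LHS](Yyp p) -braid5 xKp. Qed.

End Braided.

Record q3pair x X y Y : Prop := Q3pair {
  q3_x : cubic x X;
  q3_y : cubic y Y;
  q3_braid : x * y * x = y * x * y;
  q3_rel : Q_relator a x y X Y = 0 }.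

End Cubic.

Section PairCubic.
Variables (R : comUnitRingType) (a b c : R) (A : algType R).
Hypotheses (ua : a \is a GRing.unit) (ub : b \is a GRing.unit)
  (uc : c \is a GRing.unit).
Implicit Types (p q : A) (D : set A).
Notation dl := (a * b * c).
Section Pair.
Variables x X y Y : A.
Hypothesis xy : q3pair a b c x X y Y.

Let cx := q3_x xy.
Let cy := q3_y xy.
Let xK := cubicVr (q3_x xy).
Let Xx := cubicVl (q3_x xy).
Let yK := cubicVr (q3_y xy).
Let Yy := cubicVl (q3_y xy).
Let xyx := q3_braid xy.
Let xKp p := canc p xK.
Let Xxp p := canc p Xx.
Let yKp p := canc p yK.
Let Yyp p := canc p Yy.
Let xy1 p := braid1 xyx p.
Let xy2 p := braid2 xK Yy xyx p.
Let xy3 p := braid3 Xx yK xyx p.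
Let xy4 p := braid4 xK Xx yK Yy xyx p.
Let xy5 p := braid5 xK Xx yK Yy xyx p.

Ltac closeL Dl DL :=
  rewrite ?mul1r -?mulrA; do ?[assumption | apply: (Dl) | apply: (DL)];
  try by [].

(* Only [Y] and [Y X], but not [Y x], are needed in [D]: see [eig3_spm]. *)
Lemma rel_mulr D : submodule D -> lclosed x D ->
    D 1 -> D y -> D (y * x) -> D (y * X) -> D Y -> D (Y * X) ->
  D (x * y * X * y - a *: (y * X * y)).
Proof.
move=> Ds Dl D1 Dy Dyx DyX DY DYX.
have DL : lclosed X D by exact: (lclosedV ua ub uc cx Ds Dl).
have Dyy : D (y * y) by exact: (cubic_sqr_mem cy).
(* Right multiplication by [y] turns the words [x y X] and [y X] of the relation into the two words
   of the goal. By braid moves, each of the ten other words becomes a word known to lie in [D],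
   possibly preceded by letters [x] and [X]. *)
have e : 1 * Q_relator a x y X Y * y = 0 by rewrite (q3_rel xy) mulr0 mul0r.
have Dl1 : D x by rewrite -[x]mulr1; apply: (Dl).
have DL1 : D X by rewrite -[X]mulr1; apply: (DL).
rewrite -[_ - _]addr0 -{}e /Q_relator; expand.
lin_mem Ds; rewrite -[_ * _]mul1r ?mulrA.
- rewrite -(xy4 (1 * x)); closeL Dl DL.
- rewrite xy5 Yyp; closeL Dl DL.
- rewrite -(xy4 1); closeL Dl DL.
- rewrite -xy2; closeL Dl DL.
- rewrite -xy1; closeL Dl DL.
- rewrite Yyp; closeL Dl DL.
- closeL Dl DL.
- rewrite Yyp; closeL Dl DL.
- closeL Dl DL.
- rewrite xy3 Yyp; closeL Dl DL.
Qed.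

End Pair.
End PairCubic.

(** * Symmetries of the relations *)

Section Converse.
Variables (R : comNzRingType) (A : algType R).

HB.instance Definition _ := GRing.Lmodule.copy A^c A.

Lemma converse_scalerAl (k : R) (x y : A^c) : k *: (x * y) =
  @GRing.mul A^c (k *: x) y.
Proof. exact: (scalerAr k (y : A) (x : A)). Qed.
HB.instance Definition _ :=
  GRing.Lmodule_isLalgebra.Build R A^c converse_scalerAl.

Lemma converse_scalerAr (k : R) (x y : A^c) : k *: (x * y) =
  @GRing.mul A^c x (k *: y).
Proof. exact: (scalerAl k (y : A) (x : A)). Qed.
HB.instance Definition _ :=
  GRing.Lalgebra_isAlgebra.Build R A^c converse_scalerAr.

End Converse.

Section Symmetry.
Variables (R : comUnitRingType) (a b c : R) (A : algType R).
Hypotheses (ua : a \is a GRing.unit) (ub : b \is a GRing.unit)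
  (uc : c \is a GRing.unit).

(** The converse reverses the three factors, which commute with each other. *)
Lemma cubicC (x X : A) : cubic a b c x X -> @cubic R a b c A^c x X.
Proof.
case=> xK Xx e; split; [exact: Xx | exact: xK |].
rewrite -[RHS]e /cubic_relator.
change ((x - c%:A) * ((x - b%:A) * (x - a%:A)) =
  (x - a%:A) * (x - b%:A) * (x - c%:A)).
expand; lin_eq.
Qed.

(** Reversing all words takes the relator to its negative. *)
Lemma q3pairC (x X y Y : A) :
  q3pair a b c x X y Y -> @q3pair R a b c A^c x X y Y.
Proof.
case=> cx cy br rel; split; [exact: cubicC | exact: cubicC | |].
  by change (x * (y * x) = y * (x * y)); rewrite !mulrA.
have e : - Q_relator a x y X Y = 0 by rewrite rel oppr0.
change (x * (y * X)
  - (X * (y * x) - a^-1 *: (y * x) + a *: (Y * x) + a *: (y * X)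
     - a ^+ 3 *: (Y * X) + a^-1 *: (x * y) - a *: (X * y)
     - a *: (x * Y) + a ^+ 3 *: (X * Y) + a ^+ 2 *: (x * (Y * X))
     - a ^+ 2 *: (X * (Y * x))) = 0).
rewrite -[RHS]e /Q_relator; expand; lin_eq.
Qed.

(** Since [X - k^-1 = - k^-1 (x - k) X] and [X] commutes with [x - k], the relator of [X] is a
    scalar multiple of that of [x] times [X^3]. *)
Lemma cubicV (x X : A) : cubic a b c x X -> cubic a^-1 b^-1 c^-1 X x.
Proof.
case=> xK Xx e; split; [exact: Xx | exact: xK |].
have fE k : k \is a GRing.unit -> X - k^-1%:A = - k^-1 *: ((x - k%:A) * X).
  move=> uk; rewrite mulrBl xK mulr_algl scalerBr scalerA !scaleNr mulNr.
  by rewrite mulVr // !scaleNr scale1r opprK addrC.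
have fC k : X * (x - k%:A) = (x - k%:A) * X.
  by rewrite mulrBl mulrBr xK Xx mulr_algl mulr_algr.
rewrite /cubic_relator !fE // -!(scalerAl, scalerAr) !mulrA.
rewrite -[_ * X * (x - b%:A)]mulrA fC !mulrA.
rewrite -[_ * X * (x - c%:A)]mulrA fC !mulrA.
rewrite -[_ * X * (x - c%:A)]mulrA fC !mulrA.
by rewrite -/(cubic_relator a b c x) e !mul0r !scaler0.
Qed.

(** The relator of the inverses, with [a^-1] for [a], is [a^-2] times the original one; [a^-1] is
    generalised to [a'] so that [ring] can work modulo [a a' = 1]. *)
Lemma q3pairV (x X y Y : A) :
  q3pair a b c x X y Y -> q3pair a^-1 b^-1 c^-1 X x Y y.
Proof.
case=> cx cy br rel; split; [exact: cubicV | exact: cubicV | |].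
  have [xK Xx _] := cx; have [yK Yy _] := cy.
  by have := braid6 xK Xx yK Yy br 1; rewrite !mul1r.
have e : a^-1 ^+ 2 *: Q_relator a x y X Y = 0 by rewrite rel scaler0.
have h : a * a^-1 = 1 by exact: mulrV.
rewrite -[RHS]e /Q_relator invrK; move: (a^-1) h => a' h.
lin_eq_by ltac:(ring: h).
Qed.

End Symmetry.

(** * Two generators *)

Section PairTheory.
Variables (R : comUnitRingType) (a b c : R) (A : algType R).
Hypotheses (ua : a \is a GRing.unit) (ub : b \is a GRing.unit)
  (uc : c \is a GRing.unit).
Implicit Types (x X y Y p q w : A) (D : set A).
Notation dl := (a * b * c).

Lemma rel_mull x X y Y D : q3pair a b c x X y Y -> submodule D -> rclosed x D ->
    D 1 -> D y -> D (x * y) -> D (X * y) -> D Y -> D (X * Y) ->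
  D (y * X * y * x - a *: (y * X * y)).
Proof.
move=> xy Ds Dr D1 Dy Dxy DXy DY DXY.
have := @rel_mulr R a b c A^c ua ub uc x X y Y (q3pairC xy) D Ds Dr D1 Dy Dxy
  DXy DY DXY.
change (D (y * (X * (y * x)) - a *: (y * (X * y))) ->
  D (y * X * y * x - a *: (y * X * y))).
by rewrite !mulrA.
Qed.

(** For [x] and [y] satisfying the cubic relation, the least such [D] is [u_x u_y u_x], where [u_x]
    is the span of [1], [x], [X]. Allowing every [D] of this kind makes the results available for
    submodules pulled back along a product. *)
Definition uu_closed x y Y D :=
  [/\ submodule D, biclosed x D, D 1, D y & D Y].

(** Brings eigenvector statements obtained for the inverted generators back to the generators
    themselves. *)
Lemma eig_inv x X (k : R) D w : k \is a GRing.unit -> x * X = 1 ->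
  submodule D -> lclosed x D -> D (X * w - k^-1 *: w) -> D (x * w - k *: w).
Proof.
move=> uk xK Ds Dx /Dx; rewrite mulrBr mulrA xK mul1r -scalerAr.
move=> /(submZ Ds (- k)); rewrite scalerBr scalerA mulNr mulrV // !scaleNr.
by rewrite scale1r opprK addrC.
Qed.

Section Pair.
Variables x X y Y : A.
Hypothesis xy : q3pair a b c x X y Y.
Let cx := q3_x xy.
Let cy := q3_y xy.
Let xK := cubicVr (q3_x xy).
Let Xx := cubicVl (q3_x xy).
Let yK := cubicVr (q3_y xy).
Let Yy := cubicVl (q3_y xy).
Let xyx := q3_braid xy.

Section Closed.
Variable D : set A.
Hypothesis D_uu : uu_closed x y Y D.

Lemma uu_closedV : uu_closed X Y y D.
Proof.
case: D_uu => Ds [Dl Dr] D1 Dy DY; split=> //; split.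
  exact: (lclosedV ua ub uc cx).
exact: (rclosedV ua ub uc cx).
Qed.

Lemma uu_eig_l : D (x * (y * X * y) - a *: (y * X * y)).
Proof.
have [_ [DL DR] _ _ _] := uu_closedV.
case: D_uu => Ds [Dl Dr] D1 Dy DY; rewrite !mulrA.
by apply: (rel_mulr ua ub uc xy Ds) => //; [exact: Dr | exact: DR | exact: DR].
Qed.

Lemma uu_eig_r : D (y * X * y * x - a *: (y * X * y)).
Proof.
have [_ [DL DR] _ _ _] := uu_closedV.
case: D_uu => Ds [Dl Dr] D1 Dy DY.
by apply: (rel_mull xy Ds) => //; [exact: Dl | exact: DL | exact: DL].
Qed.

(** The cubic relation of [y], multiplied on the right by [x Y], gives
    [dl Y x Y = y y x Y = y X y x] modulo [D], and the last word is [a y X y] by [uu_eig_r]. *)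
Lemma uu_invE : D (Y * x * Y - (dl^-1 * a) *: (y * X * y)).
Proof.
have [_ [DL DR] _ _ _] := uu_closedV.
have [Ds [Dl Dr] D1 Dy DY] := D_uu.
have udl : dl \is a GRing.unit by exact: dl_unit.
have E1 : D (1 * 1 * (x * Y)) by rewrite !mul1r; exact: Dl.
have Ey : D (1 * y * (x * Y)).
  by rewrite mulrA (braid2 yK Xx (esym xyx)) mul1r; apply: (Dr); apply: (DL).
have := cubic_sqr cy (subm_sandwich 1 (x * Y) Ds) E1 Ey.
rewrite /= mul1r mulrBl -scalerAl !mulrA.
rewrite (braid2 yK Xx (esym xyx)) => /(submBC Ds) h.
have /(submBT Ds) /(_ uu_eig_r) /(submBZ Ds dl^-1) := h.
by rewrite !scalerA mulVr // scale1r.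
Qed.

End Closed.

(* [y x w = x y x w Y], so that [a y w] and [a x w] agree modulo [D]. *)
Lemma conj_eig D w : submodule D -> biclosed x D -> biclosed y D ->
  D (x * w - a *: w) -> y * w = w * y -> D (y * w - a *: w).
Proof.
move=> Ds [Dxl Dxr] [Dyl Dyr] Dxw yw.
have DYr : rclosed Y D by exact: (rclosedV ua ub uc cy).
have wY p : p * w * Y = p * Y * w.
  by rewrite -[in RHS](canc w yK) -yw !mulrA (canc _ Yy).
apply: (submBT Ds _ Dxw).
have /Dyl yxw := Dxw; have /Dyl /Dxl /DYr := Dxw.
rewrite !(mulrBr, mulrBl) -!(scalerAr, scalerAl) !mulrA !wY xyx !(canc _ yK).
move: yxw; rewrite mulrBr -scalerAr mulrA => /(submBC Ds) /(submBT Ds) h /h.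
by move/(submBZ Ds a^-1); rewrite !scalerA mulVr // !scale1r.
Qed.

End Pair.
End PairTheory.

(** * Generated subalgebras, and submodules enlarged by one element *)

Section Generated.
Variables (R : comUnitRingType) (A : algType R).
Implicit Types (x p q w : A) (D S : set A).

(** The subalgebra generated by [S]. Stability is asked on the left only, so that induction adds one
    letter at a time in front; [gen_mul] recovers closure under products. *)
Definition gen S : set A :=
  smallest (fun D => submodule D /\ forall g, S g -> lclosed g D) [set 1].

Lemma gen_ind S D : submodule D -> D 1 -> (forall g, S g -> lclosed g D) ->
  gen S `<=` D.
Proof. by move=> Ds D1 Dl p; apply; split=> // _ ->. Qed.

Lemma gen_sub S : submodule (gen S).
Proof.
split; first by move=> D [[Ds _] _]; exact: subm0.
by move=> r u v Gu Gv D HD; have [[Ds _] _] := HD; apply: Ds.2;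
  [exact: Gu | exact: Gv].
Qed.

Lemma gen1 S : gen S 1.
Proof. by move=> D [_ ]; exact. Qed.

Lemma gen_l S g : S g -> lclosed g (gen S).
Proof. by move=> Sg p Gp D HD; have [[_ Dl] _] := HD; apply: (Dl _ Sg);
  exact: Gp. Qed.

Lemma gen_gen S g : S g -> gen S g.
Proof. by move=> Sg; rewrite -[g]mulr1; apply: gen_l => //; exact: gen1. Qed.

Lemma gen_lclosed S D p : submodule D -> (forall g, S g -> lclosed g D) ->
  gen S p -> lclosed p D.
Proof.
move=> Ds Dl Gp d Dd; rewrite -[p * d]mul1r mulrA.
apply: (gen_ind (D := [set p | D (1 * p * d)])) Gp => /=.
- exact: subm_sandwich.
- by rewrite !mul1r.
- by move=> g Sg e /=; rewrite !mul1r -mulrA; exact: Dl.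
Qed.

(** The induction adds letters on the left of [p], next to [d], so the statement is proved for all
    [d] at once. *)
Lemma gen_rclosed S D p : submodule D -> (forall g, S g -> rclosed g D) ->
  gen S p -> rclosed p D.
Proof.
move=> Ds Dr Gp.
apply: (gen_ind (D := [set p | rclosed p D])) Gp => /=.
- split=> [d Dd|r u v Hu Hv d Dd]; first by rewrite mulr0; exact: subm0.
  by rewrite mulrDr -scalerAr; apply: Ds.2; [exact: Hu | exact: Hv].
- by move=> d; rewrite mulr1.
- by move=> g Sg q Hq d Dd; rewrite mulrA; apply: Hq; exact: Dr.
Qed.

Lemma gen_mul S p q : gen S p -> gen S q -> gen S (p * q).
Proof.
by move=> Gp; apply: (gen_lclosed (gen_sub S)) Gp q => g; exact: gen_l.
Qed.

Lemma gen_mono S S' : S `<=` S' -> gen S `<=` gen S'.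
Proof.
move=> SS; apply: gen_ind; [exact: gen_sub | exact: gen1 |].
by move=> g /SS; exact: gen_l.
Qed.

Lemma gen_comm S v p : (forall g, S g -> g * v = v * g) -> gen S p -> p * v =
  v * p.
Proof.
move=> Sv; apply: (gen_ind (D := [set p | p * v = v * p])).
- split=> [|r u w /= eu ew]; first by rewrite /= mul0r mulr0.
  by rewrite mulrDl mulrDr -scalerAl -scalerAr eu ew.
- by rewrite /= mul1r mulr1.
- by move=> g /Sv gv q /= qv; rewrite mulrA -gv -!mulrA qv.
Qed.

(** This is [D + R w]. *)
Definition adjoin D w : set A := [set x | exists r, D (x - r *: w)].

Lemma adjoin_sub D w : submodule D -> submodule (adjoin D w).
Proof.
move=> Ds; split; first by exists 0; rewrite scale0r subr0; exact: subm0.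
move=> r u v [ru Du] [rv Dv]; exists (r * ru + rv).
have := Ds.2 r _ _ Du Dv; congr D.
by rewrite scalerBr scalerA scalerDl opprD addrACA.
Qed.

Lemma adjoin_base D w : submodule D -> D `<=` adjoin D w.
Proof. by move=> Ds u Du; exists 0; rewrite scale0r subr0. Qed.

Lemma adjoin_new D w : submodule D -> adjoin D w w.
Proof. by move=> Ds; exists 1; rewrite scale1r subrr; exact: subm0. Qed.

Lemma adjoin_ind D D' w : submodule D' -> D `<=` D' -> D' w -> adjoin D w `<=`
  D'.
Proof.
move=> Ds DD Dw u [r /DD]; move/(submDr Ds); apply.
by apply: submN => //; exact: submZ.
Qed.

Lemma adjoin_mono D D' w : D `<=` D' -> adjoin D w `<=` adjoin D' w.
Proof. by move=> DD u [r /DD]; exists r. Qed.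

Lemma adjoin_lclosed D w x k : submodule D -> lclosed x D ->
  D (x * w - k *: w) -> lclosed x (adjoin D w).
Proof.
move=> Ds Dx Dw u [r /Dx Du]; exists (r * k).
have := submD Ds Du (submZ Ds r Dw); congr D.
by rewrite mulrBr -scalerAr scalerBr scalerA subrKA.
Qed.

Lemma adjoin_rclosed D w x k : submodule D -> rclosed x D ->
  D (w * x - k *: w) -> rclosed x (adjoin D w).
Proof.
move=> Ds Dx Dw u [r /Dx Du]; exists (r * k).
have := submD Ds Du (submZ Ds r Dw); congr D.
by rewrite mulrBl -scalerAl scalerBr scalerA subrKA.
Qed.

End Generated.

(** * The algebra generated by two neighbouring generators *)

Section PairStructure.
Variables (R : comUnitRingType) (a b c : R) (A : algType R).
Hypotheses (ua : a \is a GRing.unit) (ub : b \is a GRing.unit)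
  (uc : c \is a GRing.unit).
Variables x X y Y : A.
Hypothesis xy : q3pair a b c x X y Y.
Let cx := q3_x xy.
Let cy := q3_y xy.
Let xK := cubicVr (q3_x xy).
Let Xx := cubicVl (q3_x xy).
Let yK := cubicVr (q3_y xy).
Let Yy := cubicVl (q3_y xy).
Let xyx := q3_braid xy.

Lemma genV S : S x -> gen S X.
Proof.
move=> Sx; rewrite -[X]mulr1.
by apply: (lclosedV ua ub uc cx (gen_sub S) (gen_l Sx)); exact: gen1.
Qed.

Let U := smallest (uu_closed x y Y) set0.

Let U_closed : uu_closed x y Y U.
Proof.
split=> [||D [[]]|D [[]]|D [[]]] //.
  split; first by move=> D [[Ds]] *; exact: subm0.
  move=> r u v Uu Uv D HD; have [[Ds _ _ _ _] _] := HD.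
  by apply: Ds.2; [exact: Uu | exact: Uv].
by split=> u Uu D HD; have [[_ [Dl Dr] _ _ _] _] := HD; [apply: Dl|apply: Dr];
  exact: Uu.
Qed.

Let Z := adjoin U (y * X * y).

(** Here [U] is [u_x u_y u_x] and [Z] is [U + R z] with [z = y X y]. It suffices that [Z] is stable
    under left multiplication by [x], which holds because [z] is an eigenvector modulo [U], and by
    [y]. *)
Lemma pair_struct D : uu_closed x y Y D -> gen [set x;
  y] `<=` adjoin D (y * X * y).
Proof.
move=> D_uu.
have UD : U `<=` D by move=> u; apply; split.
suff GZ : gen [set x; y] `<=` Z by move=> u /GZ; exact: adjoin_mono.
have [Us [Ul Ur] U1 Uy UY] := U_closed.
have Zs : submodule Z by exact: adjoin_sub.
have UZ : U `<=` Z by exact: adjoin_base.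
have Zl : lclosed x Z.
  by apply: (adjoin_lclosed (k := a)) => //;
    exact: (uu_eig_l ua ub uc xy U_closed).
have Zr : rclosed x Z.
  by apply: (adjoin_rclosed (k := a)) => //;
    exact: (uu_eig_r ua ub uc xy U_closed).
have ZL : lclosed X Z by exact: (lclosedV ua ub uc cx).
have ZR : rclosed X Z by exact: (rclosedV ua ub uc cx).
have Z1 := UZ _ U1; have Zy := UZ _ Uy; have ZY := UZ _ UY.
apply: gen_ind => // g [->|->] //.
have Zz : Z (y * X * y) by exact: adjoin_new.
have Zsub p : submodule [set d | Z (p * d)].
  by have := subm_sandwich p 1 Zs; congr submodule; apply/funext => d;
    rewrite /= mulr1.
apply: (adjoin_ind (D' := [set d | Z (y * d)])) => //=.
(* To show that [y U] lies in [Z], the words [y x d] and [y X d] are carried along, which makes the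
   condition stable under left multiplication by [x]. *)
- pose T := [set d | [/\ Z (y * d), Z (y * x * d) & Z (y * X * d)]].
  suff T_uu : uu_closed x y Y T by move=> u /(_ T) []; first by split.
  split.
  + split; first by rewrite /T /= !mulr0; split; exact: subm0.
    by move=> r u v [u1 u2 u3] [v1 v2 v3]; split; apply: (Zsub _).2.
  + split=> d [d1 d2 d3]; last by split; rewrite mulrA; exact: Zr.
    split; rewrite ?mulrA ?(canc _ Xx) //.
    have := cubic_sqr_mem cx (subm_sandwich y d Zs).
    by rewrite /= !mulr1 !mulrA; apply.
  + by split; rewrite mulr1 //; [exact: Zr | exact: ZR].
  + split=> //; first exact: (cubic_sqr_mem cy Zs).
    by rewrite -xyx; apply: (Zr); exact: Zl.
  + split; first by rewrite yK.
      by have := braid2 yK Xx (esym xyx) 1; rewrite !mul1r => ->; apply: (Zr);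
        exact: ZL.
    by have := braid4 yK Yy xK Xx (esym xyx) 1; rewrite !mul1r => ->;
      apply: (Zr); exact: ZL.
(* [y z = y^2 X y], and [y^2] is a combination of [1], [y] and [Y]. *)
- have := cubic_sqr_mem cy (subm_sandwich 1 (X * y) Zs);
    rewrite /= !mul1r !mulrA; apply.
  + exact: ZL.
  + by [].
  + by have := braid5 yK Yy xK Xx (esym xyx) 1; rewrite !mul1r => ->;
      apply: (ZR); exact: Zl.
Qed.

End PairStructure.

(** * Three generators *)

Section Words.
Variable A : pzRingType.
Implicit Types x X y Y v V g p : A.

Lemma comm_inv x X v : x * X = 1 -> X * x = 1 -> x * v = v * x -> X * v = v * X.
Proof.
by move=> xK Xx e; rewrite -[X * v]mulr1 -xK [_ * (x * X)]mulrA -[X * v *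
  x]mulrA -e mulrA Xx mul1r.
Qed.

Lemma comm_at x v p : x * v = v * x -> p * x * v = p * v * x.
Proof. by move=> e; rewrite -!mulrA e. Qed.

End Words.

Section FourStrands.
Variables (R : comUnitRingType) (A : algType R).
Implicit Types (a b c : R) (x X y Y p q w g : A) (D : set A).

Record q4data a b c (s1 t1 s2 t2 s3 t3 : A) : Prop := Q4data {
  q4_12 : q3pair a b c s1 t1 s2 t2;
  q4_23 : q3pair a b c s2 t2 s3 t3;
  q4_13 : s1 * s3 = s3 * s1 }.

(** Read from the right: [Y v y = v y V], then [V] passes through [g], and [V Y v = y V Y]. The
    outer pair [v], [V] is thereby traded for two letters [v] around the shorter word [y g Y]. *)
Lemma slide_mixed a b c y Y v V g : q3pair a b c y Y v V -> g * v = v * g ->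
  v * y * g * y * V = Y * v * (y * g * Y) * v * y.
Proof.
case=> -[yK Yy _] [vK Vv _] yvy _ gv.
have gV p : p * V * g = p * g * V.
  by rewrite -!mulrA (comm_inv vK Vv (esym gv)).
rewrite -[RHS]mul1r !mulrA -(braid2 vK Yy (esym yvy) 1) mul1r gV.
by rewrite (braid5 vK Vv yK Yy (esym yvy)) (canc _ Yy).
Qed.

Lemma q4dataV a b c s1 t1 s2 t2 s3 t3 : a \is a GRing.unit ->
    b \is a GRing.unit -> c \is a GRing.unit ->
  q4data a b c s1 t1 s2 t2 s3 t3 -> q4data a^-1 b^-1 c^-1 t1 s1 t2 s2 t3 s3.
Proof.
move=> ua ub uc [q12 q23 c13]; split; [exact: q3pairV | exact: q3pairV |].
have [[s1K t1K _] _ _ _] := q12; have [_ [s3K t3K _] _ _] := q23.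
by apply: (comm_inv s1K t1K); apply/esym; exact: (comm_inv s3K t3K (esym c13)).
Qed.

Section Four.
Variables a b c : R.
Hypotheses (ua : a \is a GRing.unit) (ub : b \is a GRing.unit)
  (uc : c \is a GRing.unit).
Variables s1 t1 s2 t2 s3 t3 : A.
Hypothesis H : q4data a b c s1 t1 s2 t2 s3 t3.
Let q12 := q4_12 H.
Let q23 := q4_23 H.
Let s1K := cubicVr (q3_x q12).
Let t1K := cubicVl (q3_x q12).
Let s2K := cubicVr (q3_x q23).
Let t2K := cubicVl (q3_x q23).
Let s3K := cubicVr (q3_y q23).
Let t3K := cubicVl (q3_y q23).
Let s1s3 : s1 * s3 = s3 * s1 := q4_13 H.
Let t1s3 : t1 * s3 = s3 * t1 := comm_inv s1K t1K s1s3.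
Let s1t3 : s1 * t3 = t3 * s1 := esym (comm_inv s3K t3K (esym s1s3)).

(** After [slide_mixed], the inner word is [s2 t1 t2 = t1 t2 s1], whose outer letters commute with
    [s3]. *)
Lemma mixed_zE : s3 * (s2 * t1 * s2) * t3 = t2 * t1 * (s3 * t2 * s3) * s1 * s2.
Proof.
have [_ _ br _] := q12.
rewrite !mulrA (slide_mixed q23 t1s3).
have -> : s2 * t1 * t2 = t1 * t2 * s1.
  by have := braid5 s1K t1K s2K t2K br 1; rewrite !mul1r => ->.
by rewrite !mulrA -[_ * s1 * s3]mulrA s1s3 -(mulrA t2 s3) -t1s3 !mulrA.
Qed.

(* In the names of the fields and lemmas, [p] stands for a generator and [n] for
   the inverse of a generator. *)
Record L_closed D : Prop := LClosed {
  L_sub : submodule D;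
  L_bi1 : biclosed s1 D;
  L_bi2 : biclosed s2 D;
  L_1 : D 1;
  L_s3 : D s3;
  L_t3 : D t3;
  L_pnp : D (s3 * t2 * s3);
  L_npn : D (t3 * s2 * t3) }.

(** [uu_invE] expresses [t3 s2 t3] through [s3 t2 s3]. *)
Lemma L_closed_mk D : submodule D -> biclosed s1 D -> biclosed s2 D ->
  D 1 -> D s3 -> D t3 -> D (s3 * t2 * s3) -> L_closed D.
Proof.
move=> Ds D1l D2l D1 Ds3 Dt3 Dpnp; split=> //.
have D_uu : uu_closed s2 s3 t3 D by split.
by apply: (submBr Ds (uu_invE ua ub uc q23 D_uu)); exact: submZ.
Qed.

Notation B3 := (gen [set s1; s2]).
Notation wp := (s3 * s2 * t1 * s2 * s3).
Notation wm := (t3 * t2 * s1 * t2 * t3).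

Section Closed.
Variable D : set A.
Hypothesis D_L : L_closed D.
Let Ds := L_sub D_L.
Let D1l := (L_bi1 D_L).1.
Let D1r := (L_bi1 D_L).2.
Let D2l := (L_bi2 D_L).1.
Let D2r := (L_bi2 D_L).2.
Let DV1l : lclosed t1 D := lclosedV ua ub uc (q3_x q12) Ds D1l.
Let DV1r : rclosed t1 D := rclosedV ua ub uc (q3_x q12) Ds D1r.
Let DV2l : lclosed t2 D := lclosedV ua ub uc (q3_x q23) Ds D2l.
Let DV2r : rclosed t2 D := rclosedV ua ub uc (q3_x q23) Ds D2r.
Let D1 := L_1 D_L.
Let Ds3 := L_s3 D_L.
Let Dt3 := L_t3 D_L.

Lemma sandwich_uu u v : s1 * u = u * s1 -> s1 * v = v * s1 ->
    D (u * 1 * v) -> D (u * s2 * v) -> D (u * t2 * v) ->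
  uu_closed s1 s2 t2 [set p | D (u * p * v)].
Proof.
move=> eu ev h1 h2 h3; split=> //; first exact: subm_sandwich.
split=> p /= Dp; first by rewrite mulrA -eu -!mulrA; apply: (D1l);
  rewrite mulrA.
by rewrite -mulrA -(mulrA p) ev !mulrA; exact: D1r.
Qed.

(** By [pair_struct] only [1], [s2], [t2] and [s2 t1 s2] have to be placed between [s3] and [t3]:
    braid moves settle the first three and [mixed_zE] the last. *)
Lemma L_mixed p : B3 p -> D (s3 * p * t3).
Proof.
pose D0 := [set p | D (s3 * p * t3)].
have D_uu : uu_closed s1 s2 t2 D0.
  have [_ _ br _] := q23.
  apply: sandwich_uu => //; first by rewrite mulr1 s3K.
    have := braid2 s3K t2K (esym br) 1; rewrite !mul1r => ->.
    by apply: (D2r); exact: DV2l.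
  have := braid4 s3K t3K s2K t2K (esym br) 1; rewrite !mul1r => ->.
  by apply: (D2r); exact: DV2l.
move=> /(pair_struct ua ub uc q12 D_uu); apply: (adjoin_ind (D' := D0)) => //;
  first by case: D_uu.
rewrite /D0 /= mixed_zE -!mulrA.
apply: (DV2l); apply: (DV1l); rewrite !mulrA.
by apply: (D2r); apply: (D1r); exact: L_pnp D_L.
Qed.

Lemma sandwich_s3 : uu_closed s1 s2 t2 [set p | D (s3 * p * s3)].
Proof.
have [_ _ br _] := q23.
apply: sandwich_uu => //; last exact: L_pnp D_L.
  by rewrite mulr1; apply: (cubic_sqr_mem (q3_y q23)).
by rewrite -br; apply: (D2r); exact: D2l.
Qed.

Lemma wplus_eig_l : D (s1 * wp - a *: wp) /\ D (s2 * wp - a *: wp).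
Proof.
have [_ _ br _] := q23.
have h1 : D (s1 * wp - a *: wp).
  have := uu_eig_l ua ub uc q12 sandwich_s3.
  by rewrite /= mulrBr mulrBl -scalerAr -scalerAl !mulrA s1s3.
split=> //; apply: (conj_eig ua ub uc q12) => //.
(* There remains that [s2] commutes with [wp]: one braid move on each side of [t1], with [s3]
   crossing [t1] in between. *)
have e := braid1 br; have e' := braid1 (esym br).
have c31 p : p * s3 * t1 = p * t1 * s3 by rewrite -!mulrA t1s3.
have := e 1; rewrite !mul1r !mulrA => ->.
by rewrite c31 e'.
Qed.

Lemma sandwich_pp p : D wp -> B3 p -> D (s3 * p * s3).
Proof.
pose D0 := [set p | D (s3 * p * s3)].
move=> Dwp /(pair_struct ua ub uc q12 sandwich_s3).
apply: (adjoin_ind (D' := D0)) => //; first by case: sandwich_s3.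
by rewrite /D0 /= !mulrA.
Qed.

End Closed.

Lemma B3_s1 : B3 s1. Proof. by apply: gen_gen; left. Qed.
Lemma B3_s2 : B3 s2. Proof. by apply: gen_gen; right. Qed.
Lemma B3_t1 : B3 t1. Proof. by apply: (genV ua ub uc q12); left. Qed.
Lemma B3_t2 : B3 t2. Proof. by apply: (genV ua ub uc q23); right. Qed.

End Four.

End FourStrands.

(** * Converse and inverse forms for three generators *)

Lemma q4dataC (R : comUnitRingType) (A : algType R) (a b c : R)
    (s1 t1 s2 t2 s3 t3 : A) :
  q4data a b c s1 t1 s2 t2 s3 t3 ->
  q4data (A := A^c) a b c s1 t1 s2 t2 s3 t3.
Proof.
case=> q12 q23 c13; split; [exact: q3pairC | exact: q3pairC | exact: esym].
Qed.

Lemma slide_mixedC (R : comUnitRingType) (A : algType R) (a b c : R)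
    (y Y v V g : A) :
  q3pair a b c y Y v V -> g * v = v * g ->
  V * y * g * y * v = y * v * (Y * g * y) * v * Y.
Proof.
move=> /q3pairC yv /esym gv; have e := slide_mixed (g := g : A^c) yv gv.
have {e} : V * (y * (g * (y * v))) = y * (v * (Y * (g * y) * (v * Y))) by [].
by rewrite !mulrA.
Qed.

Lemma mixed_zEC (R : comUnitRingType) (A : algType R) (a b c : R)
    (s1 t1 s2 t2 s3 t3 : A) :
  q4data a b c s1 t1 s2 t2 s3 t3 ->
  t3 * (s2 * t1 * s2) * s3 = s2 * s1 * (s3 * t2 * s3) * t1 * t2.
Proof.
move=> /q4dataC /mixed_zE e.
have {e} : t3 * ((s2 * (t1 * s2)) * s3) =
  s2 * (s1 * (s3 * (t2 * s3) * (t1 * t2))) by [].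
by rewrite !mulrA.
Qed.

Lemma L_closedC (R : comUnitRingType) (A : algType R) (s1 s2 t2 s3 t3 : A) D :
  L_closed s1 s2 t2 s3 t3 D -> L_closed (A := A^c) s1 s2 t2 s3 t3 D.
Proof.
case=> Ds [l1 r1] [l2 r2] D1 Ds3 Dt3 Dp Dn; split=> //.
  by change (D (s3 * (t2 * s3))); rewrite mulrA.
by change (D (t3 * (s2 * t3))); rewrite mulrA.
Qed.

Section FourSymmetric.
Variables (R : comUnitRingType) (A : algType R).
Implicit Types (p q w : A) (D : set A).
Variables a b c : R.
Hypotheses (ua : a \is a GRing.unit) (ub : b \is a GRing.unit)
  (uc : c \is a GRing.unit).
Variables s1 t1 s2 t2 s3 t3 : A.
Hypothesis H : q4data a b c s1 t1 s2 t2 s3 t3.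
Let q12 := q4_12 H.
Let q23 := q4_23 H.
Let HV := q4dataV ua ub uc H.
Let uaV : a^-1 \is a GRing.unit. Proof. by rewrite unitrV. Qed.
Let ubV : b^-1 \is a GRing.unit. Proof. by rewrite unitrV. Qed.
Let ucV : c^-1 \is a GRing.unit. Proof. by rewrite unitrV. Qed.

Lemma L_closedV D : L_closed s1 s2 t2 s3 t3 D -> L_closed t1 t2 s2 t3 s3 D.
Proof.
case=> Ds [l1 r1] [l2 r2] D1 Ds3 Dt3 Dp Dn; split=> //; split.
- exact: (lclosedV ua ub uc (q3_x q12)).
- exact: (rclosedV ua ub uc (q3_x q12)).
- exact: (lclosedV ua ub uc (q3_x q23)).
- exact: (rclosedV ua ub uc (q3_x q23)).
Qed.

Lemma B3V : gen [set s1; s2] `<=` gen [set t1; t2].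
Proof.
apply: gen_ind; [exact: gen_sub | exact: gen1 |].
move=> g [->|->] p.
  exact: (gen_mul (B3_t1 uaV ubV ucV HV)).
exact: (gen_mul (B3_t2 uaV ubV ucV HV)).
Qed.

Section Closed.
Variable D : set A.
Hypothesis D_L : L_closed s1 s2 t2 s3 t3 D.
Let Ds := L_sub D_L.

Notation B3 := (gen [set s1; s2]).
Notation wp := (s3 * s2 * t1 * s2 * s3).
Notation wm := (t3 * t2 * s1 * t2 * t3).

Lemma L_mixedV p : B3 p -> D (t3 * p * s3).
Proof. by move/B3V; exact: (L_mixed uaV ubV ucV HV (L_closedV D_L)). Qed.

Lemma sandwich_mm p : D wm -> B3 p -> D (t3 * p * t3).
Proof. by move=> Dwm /B3V;
  exact: (sandwich_pp uaV ubV ucV HV (L_closedV D_L)). Qed.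

(** Inverting the generators exchanges [wp] and [wm]; this gives the eigenvalue [a^-1] of [t1] and
    [t2], hence [a] for [s1] and [s2]. *)
Lemma wminus_eig_l : D (s1 * wm - a *: wm) /\ D (s2 * wm - a *: wm).
Proof.
have [h1 h2] := wplus_eig_l uaV ubV ucV HV (L_closedV D_L).
have [[s1K _ _] _ _ _] := q12; have [[s2K _ _] _ _ _] := q23.
split; [apply: (eig_inv ua s1K) => // | apply: (eig_inv ua s2K) => //].
  exact: (L_bi1 D_L).1.
exact: (L_bi2 D_L).1.
Qed.

End Closed.
End FourSymmetric.

Lemma w_eig_r (R : comUnitRingType) (A : algType R) (a b c : R)
    (s1 t1 s2 t2 s3 t3 : A) (D : set A) :
  a \is a GRing.unit -> b \is a GRing.unit -> c \is a GRing.unit ->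
  q4data a b c s1 t1 s2 t2 s3 t3 -> L_closed s1 s2 t2 s3 t3 D ->
  let wp := s3 * s2 * t1 * s2 * s3 in let wm := t3 * t2 * s1 * t2 * t3 in
  (D (wp * s1 - a *: wp) /\ D (wp * s2 - a *: wp)) /\
  (D (wm * s1 - a *: wm) /\ D (wm * s2 - a *: wm)).
Proof.
move=> ua ub uc /q4dataC H /L_closedC D_L wp wm.
have wpE : wp = s3 * (s2 * (t1 * (s2 * s3))) by rewrite /wp !mulrA.
have wmE : wm = t3 * (t2 * (s1 * (t2 * t3))) by rewrite /wm !mulrA.
rewrite wpE wmE.
by split; [exact: (wplus_eig_l ua ub uc H D_L)
  | exact: (wminus_eig_l ua ub uc H D_L)].
Qed.

(** * The algebra generated by three generators *)

Section FourMain.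
Variables (R : comUnitRingType) (A : algType R).
Implicit Types (p q w : A) (D : set A).
Variables a b c : R.
Hypotheses (ua : a \is a GRing.unit) (ub : b \is a GRing.unit)
  (uc : c \is a GRing.unit).
Variables s1 t1 s2 t2 s3 t3 : A.
Hypothesis H : q4data a b c s1 t1 s2 t2 s3 t3.
Let q12 := q4_12 H.
Let q23 := q4_23 H.
Let HV := q4dataV ua ub uc H.
Let uaV : a^-1 \is a GRing.unit. Proof. by rewrite unitrV. Qed.
Let ubV : b^-1 \is a GRing.unit. Proof. by rewrite unitrV. Qed.
Let ucV : c^-1 \is a GRing.unit. Proof. by rewrite unitrV. Qed.

Section Closed.
Variable D : set A.
Hypothesis D_L : L_closed s1 s2 t2 s3 t3 D.
Let Ds := L_sub D_L.

Notation B3 := (gen [set s1; s2]).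
Notation wp := (s3 * s2 * t1 * s2 * s3).
Notation wm := (t3 * t2 * s1 * t2 * t3).

(** By [pair_struct], [p] may be taken in [u_1 u_2 u_1] or equal to [s2 t1 s2]. In each case the
    three letters [s3] are reduced to two equal letters around an element of [B3], where [wp] and
    [wm] suffice, or the cubic relation applies to [s3 s3]. *)
Lemma sandwich_pp_pnp p : D wp -> D wm -> B3 p -> D (s3 * p * (s3 * t2 * s3)).
Proof.
move=> Dwp Dwm; pose z' := s3 * t2 * s3; rewrite -/z'.
have [[s1K t1K _] _ _ _] := q12.
have [[s2K t2K _] [s3K t3K _] br _] := q23.
have D1l := (L_bi1 D_L).1; have D1r := (L_bi1 D_L).2.
have D2l := (L_bi2 D_L).1; have D2r := (L_bi2 D_L).2.
have s1s3 : s1 * s3 = s3 * s1 := q4_13 H.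
have B3s1 : B3 s1 by exact: B3_s1.
have B3s2 : B3 s2 by exact: B3_s2.
have B3t2 : B3 t2 by exact: (B3_t2 ua ub uc H).
have B3t1 : B3 t1 by exact: (B3_t1 ua ub uc H).
have B3D u : B3 u -> lclosed u D.
  by apply: gen_lclosed => // g [->|->].
have G1 u : gen [set s1] u -> B3 u by apply: gen_mono => g ->; left.
have G1c u : gen [set s1] u -> u * s3 = s3 * u by apply: gen_comm => g ->.
have G1c' u : gen [set s1] u -> u * t3 = t3 * u.
  by move=> /G1c e; apply/esym; apply: (comm_inv s3K t3K).
have qs3 q u : gen [set s1] q -> u * q * s3 = u * s3 * q.
  by move=> Gq; rewrite -!mulrA G1c.
have qt3 q u : gen [set s1] q -> u * q * t3 = u * t3 * q.
  by move=> Gq; rewrite -!mulrA G1c'.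
pose E := [set u | forall r, B3 r -> D (u * r * s3)].
have E_uu : uu_closed s2 s3 t3 E.
  split.
  - split=> [r _|k u v Eu Ev r Br]; first by rewrite !mul0r; exact: (subm0 Ds).
    by rewrite !mulrDl -!scalerAl; apply: Ds.2; [exact: Eu | exact: Ev].
  - split=> u Eu r Br.
      by rewrite -!mulrA; apply: (D2l); rewrite mulrA; exact: Eu.
    by rewrite -(mulrA u); apply: Eu; exact: gen_mul.
  - by move=> r Br; rewrite mul1r; apply: (B3D) => //; exact: L_s3 D_L.
  - by move=> r Br; exact: (sandwich_pp ua ub uc H D_L).
  - by move=> r Br; exact: (L_mixedV ua ub uc H D_L).
(* The factor [q] absorbs the letters [s1] multiplied on the right of [u], which cannot be moved
   across [z']. *)
pose F := [set u | forall q, gen [set s1] q -> D (s3 * u * q * z')].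
have F_uu : uu_closed s1 s2 t2 F.
  split.
  - split=> [r _|k u v Fu Fv r Br]; first by rewrite mulr0 !mul0r;
      exact: (subm0 Ds).
    rewrite mulrDr !mulrDl -scalerAr -!scalerAl.
    by apply: Ds.2; [exact: Fu | exact: Fv].
  - split=> u Fu q Gq.
    have -> : s3 * (s1 * u) * q * z' =
      s1 * (s3 * u * q * z') by rewrite !mulrA s1s3.
      by apply: (D1l); exact: Fu.
    have -> : s3 * (u * s1) * q * z' = s3 * u * (s1 * q) * z' by rewrite !mulrA.
    by apply: Fu; exact: gen_l.
  - move=> q Gq; rewrite mulr1 -G1c // -mulrA.
    apply: (B3D) => //; first exact: G1.
    have := cubic_sqr_mem (q3_y q23) (subm_sandwich 1 (t2 * s3) Ds).
    rewrite /= !mul1r /z' !mulrA; apply.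
    + by apply: (B3D) => //; exact: L_s3 D_L.
    + exact: L_pnp D_L.
    + by apply: (L_mixedV ua ub uc H D_L).
  - move=> q Gq.
    have -> : s3 * s2 * q * z' = s2 * (s3 * (s2 * q * t2) * s3).
      by rewrite /z' !mulrA (qs3 q) // br.
    apply: (D2l); apply: (sandwich_pp ua ub uc H D_L) => //.
    by apply: gen_mul => //; apply: gen_mul => //; exact: G1.
  - move=> q Gq.
    have -> : s3 * t2 * q * z' = z' * (q * t2) * s3.
      by rewrite /z' !mulrA (qs3 q).
    have Bq : B3 (q * t2) by apply: gen_mul => //; exact: G1.
    (* Modulo [E], [t3 s2 t3] is a unit multiple of [z'] by [uu_invE]; with it in place of [z'] the
       word becomes [t3 (s2 q s2) t3 t2]. *)
    have h : D (t3 * s2 * t3 * (q * t2) * s3).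
      have -> : t3 * s2 * t3 * (q * t2) * s3 = t3 * (s2 * q * s2) * t3 * t2.
        by rewrite !mulrA -(qt3 q) // (braid5 s3K t3K s2K t2K (esym br)).
      apply: (gen_rclosed Ds _ B3t2) => [g [->|->]|] //.
      apply: (sandwich_mm ua ub uc H D_L) => //.
      by apply: gen_mul => //; apply: gen_mul => //; exact: G1.
    have /(_ _ Bq) := uu_invE ua ub uc q23 E_uu.
    rewrite !mulrBl -!scalerAl => /(submBC Ds) /(submBr Ds) /(_ h).
    have uk : (a * b * c)^-1 * a \is a GRing.unit by rewrite unitrM unitrV
      dl_unit.
    by move/(submZ Ds ((a * b * c)^-1 * a)^-1);
      rewrite scalerA mulVr // scale1r.
move=> /(pair_struct ua ub uc q12 F_uu).
apply: (adjoin_ind (D' := [set p | D (s3 * p * z')])).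
- exact: subm_sandwich.
- by move=> u /(_ 1 (gen1 (S := _))); rewrite /= mulr1.
pose G := [set u | forall r, B3 r -> D (s3 * r * u)].
have G_uu : uu_closed s2 s3 t3 G.
  split.
  - split=> [r _|k u v Gu Gv r Br]; first by rewrite mulr0; exact: (subm0 Ds).
    by rewrite mulrDr -scalerAr; apply: Ds.2; [exact: Gu | exact: Gv].
  - split=> u Gu r Br; last by rewrite mulrA; apply: (D2r); exact: Gu.
    by rewrite mulrA -(mulrA s3); apply: Gu; exact: gen_mul.
  - move=> r Br; rewrite mulr1.
    apply: (gen_rclosed Ds _ Br) => [g [->|->]|] //; exact: L_s3 D_L.
  - by move=> r Br; exact: (sandwich_pp ua ub uc H D_L).
  - by move=> r Br; exact: (L_mixed ua ub uc H D_L).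
(* Modulo [G], [s2 z'] is [a z'], so the case [p = s2 t1 s2] reduces to [s3 s2 t1 z'], which is
   covered by [F] with [q = t1]. *)
have Br : B3 (s2 * t1) by exact: gen_mul.
have /(_ _ Br) := uu_eig_l ua ub uc q23 G_uu.
rewrite -/z' mulrBr -scalerAr => h.
have e : s3 * (s2 * t1 * s2) * z' =
  s3 * (s2 * t1) * (s2 * z') by rewrite !mulrA.
rewrite /= e; apply: (submBr Ds h); apply: (submZ Ds).
have [_ _ _ Fs2 _] := F_uu; have := Fs2 t1.
rewrite !mulrA; apply.
by apply: (genV ua ub uc q12).
Qed.

End Closed.

Notation B3 := (gen [set s1; s2]).
Notation wp := (s3 * s2 * t1 * s2 * s3).
Notation wm := (t3 * t2 * s1 * t2 * t3).
Notation closed := (L_closed s1 s2 t2 s3 t3).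

Lemma L_closed_adjoin D w : closed D ->
    D (s1 * w - a *: w) /\ D (s2 * w - a *: w) ->
    D (w * s1 - a *: w) /\ D (w * s2 - a *: w) ->
  closed (adjoin D w).
Proof.
case=> Ds [l1 r1] [l2 r2] D1 Ds3 Dt3 Dp Dn [w1 w2] [w1' w2'].
split; try exact: adjoin_base; first exact: adjoin_sub.
  by split;
    [exact: (adjoin_lclosed (k := a)) | exact: (adjoin_rclosed (k := a))].
by split; [exact: (adjoin_lclosed (k := a)) | exact: (adjoin_rclosed (k := a))].
Qed.

Let L : set A := smallest closed set0.

Let L_L : closed L.
Proof.
split; try by move=> D [[]].
- split; first by move=> D [[Ds]] *; exact: subm0.
  move=> r u v Lu Lv D HD; have [[Ds _ _ _ _ _ _ _] _] := HD.
  by apply: Ds.2; [exact: Lu | exact: Lv].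
- by split=> u Lu D HD; have [[_ [l1 r1] _ _ _ _ _ _] _] := HD;
    [apply: l1 | apply: r1]; exact: Lu.
- by split=> u Lu D HD; have [[_ _ [l2 r2] _ _ _ _ _] _] := HD;
    [apply: l2 | apply: r2]; exact: Lu.
Qed.

Let Lp : set A := adjoin L wp.

Let Lp_L : closed Lp.
Proof.
by apply: L_closed_adjoin => //;
  [exact: (wplus_eig_l ua ub uc H L_L) | exact: (w_eig_r ua ub uc H L_L).1].
Qed.

Let N : set A := adjoin Lp wm.

Let N_L : closed N.
Proof.
by apply: L_closed_adjoin => //;
  [exact: (wminus_eig_l ua ub uc H Lp_L) | exact: (w_eig_r ua ub uc H Lp_L).2].
Qed.

Let N_wp : N wp.
Proof. by apply: adjoin_base; [exact: L_sub Lp_L|]; apply: adjoin_new;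
  exact: L_sub L_L. Qed.

Let N_wm : N wm.
Proof. by apply: adjoin_new; exact: L_sub Lp_L. Qed.

(** The set [T] satisfies the closure conditions, hence contains [L]; its quantifier over [B3]
    provides stability on the left. For [wp] the product starts with [s3 s3], to which the cubic
    relation applies, and for [wm] the letter [s3] cancels. *)
Let N_s3 : lclosed s3 N.
Proof.
have Ns := L_sub N_L.
have Nl u : B3 u -> lclosed u N.
  by apply: gen_lclosed => // g [->|->];
    [exact: (L_bi1 N_L).1 | exact: (L_bi2 N_L).1].
have Nr u : B3 u -> rclosed u N.
  by apply: gen_rclosed => // g [->|->];
    [exact: (L_bi1 N_L).2 | exact: (L_bi2 N_L).2].
have B3t1 : B3 t1 by exact: (B3_t1 ua ub uc H).
have B3t2 : B3 t2 by exact: (B3_t2 ua ub uc H).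
have Bz : B3 (s2 * t1 * s2) by do 2?[apply: gen_mul => //]; exact: B3_s2.
have [_ [s3K _ _] _ _] := q23.
pose T := [set x | forall y, B3 y -> N (s3 * y * x)].
have T_L : closed T.
  apply: (L_closed_mk ua ub uc H).
  - split=> [y _|k u v Tu Tv y By]; first by rewrite mulr0; exact: (subm0 Ns).
    by rewrite mulrDr -scalerAr; apply: Ns.2; [exact: Tu | exact: Tv].
  - split=> x Tx y By; last by rewrite mulrA; apply: (L_bi1 N_L).2; exact: Tx.
    by rewrite mulrA -(mulrA s3); apply: Tx; apply: gen_mul => //; exact: B3_s1.
  - split=> x Tx y By; last by rewrite mulrA; apply: (L_bi2 N_L).2; exact: Tx.
    by rewrite mulrA -(mulrA s3); apply: Tx; apply: gen_mul => //; exact: B3_s2.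
  - by move=> y By; rewrite mulr1; apply: (Nr) => //; exact: L_s3 N_L.
  - by move=> y By; exact: (sandwich_pp ua ub uc H N_L).
  - by move=> y By; exact: (L_mixed ua ub uc H N_L).
  - by move=> y By; exact: (sandwich_pp_pnp N_L).
have N's : submodule [set x | N (s3 * x)].
  by have := subm_sandwich s3 1 Ns; congr submodule; apply/funext => x;
    rewrite /= mulr1.
apply: (adjoin_ind (D' := [set x | N (s3 * x)])) => //.
  apply: (adjoin_ind (D' := [set x | N (s3 * x)])) => //.
    move=> x Lx; have /(_ 1 (gen1 (S := _))) := Lx T (conj T_L (@sub0set _ T)).
    by rewrite /= mulr1.
  have := cubic_sqr_mem (q3_y q23) (subm_sandwich 1 (s2 * t1 * s2 * s3) Ns).
  rewrite /= !mul1r !mulrA; apply=> //.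
    by apply: (Nl) => //; exact: L_s3 N_L.
  by have := L_mixedV ua ub uc H N_L Bz; rewrite !mulrA.
rewrite /= !mulrA s3K mul1r.
apply: (Nl) => //; last exact: L_t3 N_L.
by do 2?[apply: gen_mul => //]; exact: B3_s1.
Qed.

(** [N], that is [L + R wp + R wm], contains [1] and is stable under the three generators, while any
    [D] as in the hypotheses contains [N]. *)
Lemma B4_ind D : closed D -> D wp -> D wm -> gen [set s1; s2; s3] `<=` D.
Proof.
move=> D_L Dwp Dwm.
suff GN : gen [set s1; s2; s3] `<=` N.
  move=> u /GN; apply: adjoin_ind => //; first exact: L_sub D_L.
  apply: adjoin_ind => //; first exact: L_sub D_L.
  by move=> x; apply; split.
apply: gen_ind; [exact: L_sub N_L | exact: L_1 N_L |].
move=> g [[->|->]|->] //; [exact: (L_bi1 N_L).1 | exact: (L_bi2 N_L).1].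
Qed.

End FourMain.

(** * Four generators *)

Section FiveStrands.
Variables (R : comUnitRingType) (A : algType R).
Implicit Types (a b c : R) (x X y Y p q w g : A) (D : set A).

Record q5data a b c (s1 t1 s2 t2 s3 t3 s4 t4 : A) : Prop := Q5data {
  q5_q4 : q4data a b c s1 t1 s2 t2 s3 t3;
  q5_34 : q3pair a b c s3 t3 s4 t4;
  q5_14 : s1 * s4 = s4 * s1;
  q5_24 : s2 * s4 = s4 * s2 }.

Lemma q5dataV a b c s1 t1 s2 t2 s3 t3 s4 t4 : a \is a GRing.unit ->
    b \is a GRing.unit -> c \is a GRing.unit ->
  q5data a b c s1 t1 s2 t2 s3 t3 s4 t4 ->
  q5data a^-1 b^-1 c^-1 t1 s1 t2 s2 t3 s3 t4 s4.
Proof.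
move=> ua ub uc [q4 q34 c14 c24]; split; [exact: q4dataV | exact: q3pairV | |].
  have [[s1K t1K _] _ _ _] := q4_12 q4; have [_ [s4K t4K _] _ _] := q34.
  by apply: (comm_inv s1K t1K); apply/esym;
    exact: (comm_inv s4K t4K (esym c14)).
have [[s2K t2K _] _ _ _] := q4_23 q4; have [_ [s4K t4K _] _ _] := q34.
by apply: (comm_inv s2K t2K); apply/esym; exact: (comm_inv s4K t4K (esym c24)).
Qed.

(** Abstracts [Q_5^(1.5)]. These conditions persist in the converse algebra, under inversion of the
    generators, and when one of the four elements of the theorem is adjoined. *)
Record M_closed (s1 s2 t2 s3 t3 s4 t4 : A) D : Prop := MClosed {
  M_sub : submodule D;
  M_bi1 : biclosed s1 D;
  M_bi2 : biclosed s2 D;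
  M_bi3 : biclosed s3 D;
  M_1 : D 1;
  M_s4 : D s4;
  M_t4 : D t4;
  M_pn : D (s4 * t3 * s4);
  M_np : D (t4 * s3 * t4);
  M_ppnpp : D (s4 * s3 * t2 * s3 * s4);
  M_nnpnn : D (t4 * t3 * s2 * t3 * t4) }.

Section Five.
Variables a b c : R.
Hypotheses (ua : a \is a GRing.unit) (ub : b \is a GRing.unit)
  (uc : c \is a GRing.unit).
Variables s1 t1 s2 t2 s3 t3 s4 t4 : A.
Hypothesis H : q5data a b c s1 t1 s2 t2 s3 t3 s4 t4.
Let q4 := q5_q4 H.
Let q12 := q4_12 q4.
Let q23 := q4_23 q4.
Let q34 := q5_34 H.
Let s1K := cubicVr (q3_x q12).
Let t1K := cubicVl (q3_x q12).
Let s2K := cubicVr (q3_x q23).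
Let t2K := cubicVl (q3_x q23).
Let s3K := cubicVr (q3_x q34).
Let t3K := cubicVl (q3_x q34).
Let s4K := cubicVr (q3_y q34).
Let t4K := cubicVl (q3_y q34).
Let s1s4 : s1 * s4 = s4 * s1 := q5_14 H.
Let t1s4 : t1 * s4 = s4 * t1 := comm_inv s1K t1K s1s4.
Let s1t4 : s1 * t4 = t4 * s1 := esym (comm_inv s4K t4K (esym s1s4)).
Let t1t4 : t1 * t4 = t4 * t1 := esym (comm_inv s4K t4K (esym t1s4)).
Let s2s4 : s2 * s4 = s4 * s2 := q5_24 H.
Let t2s4 : t2 * s4 = s4 * t2 := comm_inv s2K t2K s2s4.
Let s2t4 : s2 * t4 = t4 * s2 := esym (comm_inv s4K t4K (esym s2s4)).
Let t2t4 : t2 * t4 = t4 * t2 := esym (comm_inv s4K t4K (esym t2s4)).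
Let br34 : s3 * s4 * s3 = s4 * s3 * s4 := q3_braid q34.

Notation closed := (M_closed s1 s2 t2 s3 t3 s4 t4).
Notation wp := (s3 * s2 * t1 * s2 * s3).
Notation wm := (t3 * t2 * s1 * t2 * t3).
Notation B4 := (gen [set s1; s2; s3]).

(** [t4 s3 t4] is not among the generators of the bimodule; [uu_invE] obtains it from [s4 t3 s4]. *)
Lemma M_closed_mk D : submodule D -> biclosed s1 D -> biclosed s2 D ->
    biclosed s3 D -> D 1 -> D s4 -> D t4 -> D (s4 * t3 * s4) ->
    D (s4 * s3 * t2 * s3 * s4) -> D (t4 * t3 * s2 * t3 * t4) -> closed D.
Proof.
move=> Ds D1l D2l D3l D1 Ds4 Dt4 Dpn Dp Dn; split=> //.
have D_uu : uu_closed s3 s4 t4 D by split.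
by apply: (submBr Ds (uu_invE ua ub uc q34 D_uu)); exact: submZ.
Qed.

Section Closed.
Variable D : set A.
Hypothesis D_M : closed D.
Let Ds := M_sub D_M.
Let D1l := (M_bi1 D_M).1.
Let D1r := (M_bi1 D_M).2.
Let D2l := (M_bi2 D_M).1.
Let D2r := (M_bi2 D_M).2.
Let D3l := (M_bi3 D_M).1.
Let D3r := (M_bi3 D_M).2.
Let DV1l : lclosed t1 D := lclosedV ua ub uc (q3_x q12) Ds D1l.
Let DV1r : rclosed t1 D := rclosedV ua ub uc (q3_x q12) Ds D1r.
Let DV2l : lclosed t2 D := lclosedV ua ub uc (q3_x q23) Ds D2l.
Let DV2r : rclosed t2 D := rclosedV ua ub uc (q3_x q23) Ds D2r.
Let DV3l : lclosed t3 D := lclosedV ua ub uc (q3_x q34) Ds D3l.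
Let DV3r : rclosed t3 D := rclosedV ua ub uc (q3_x q34) Ds D3r.

Lemma sandwich_bi x u v : x * u = u * x -> x * v = v * x -> biclosed x D ->
  biclosed x [set p | D (u * p * v)].
Proof.
move=> eu ev [Dl Dr]; split=> p /= Dp.
  by rewrite mulrA -eu -!mulrA; apply: (Dl); rewrite mulrA.
by rewrite -mulrA -(mulrA p) ev !mulrA; exact: Dr.
Qed.

(** Pulled back along [p |-> s4 p s4], [D] meets the conditions of one strand fewer, so the results
    on three generators apply to it. *)
Lemma sandwich_s4 : L_closed s1 s2 t2 s3 t3 [set p | D (s4 * p * s4)].
Proof.
apply: (L_closed_mk ua ub uc q4).
- exact: subm_sandwich.
- by apply: sandwich_bi => //; exact: M_bi1 D_M.
- by apply: sandwich_bi => //; exact: M_bi2 D_M.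
- rewrite /= mulr1; apply: (cubic_sqr_mem (q3_y q34)) => //.
  + exact: M_1 D_M.
  + exact: M_s4 D_M.
  + exact: M_t4 D_M.
- by rewrite /= -br34; apply: (D3r); apply: (D3l); exact: M_s4 D_M.
- exact: M_pn D_M.
- by rewrite /= !mulrA; exact: M_ppnpp D_M.
Qed.

(** [B4_ind] leaves finitely many words; those of length at least three are slid past [s4] and [t4]
    until a generator of the bimodule remains, with letters [s1], [s2], [s3] and inverses
    outside. *)
Lemma M_mixed p : B4 p -> D (s4 * p * t4).
Proof.
move: p; apply: (B4_ind ua ub uc q4 (D := [set p | D (s4 * p * t4)])).
- apply: (L_closed_mk ua ub uc q4).
  + exact: subm_sandwich.
  + by apply: sandwich_bi => //; exact: M_bi1 D_M.
  + by apply: sandwich_bi => //; exact: M_bi2 D_M.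
  + by rewrite /= mulr1 s4K; exact: M_1 D_M.
  + have := braid2 s4K t3K (esym br34) 1; rewrite /= !mul1r => ->.
    by apply: (D3r); apply: (DV3l); exact: M_s4 D_M.
  + have := braid4 s4K t4K s3K t3K (esym br34) 1; rewrite /= !mul1r => ->.
    by apply: (D3r); apply: (DV3l); exact: M_t4 D_M.
  + rewrite /= !mulrA (slide_mixed q34 t2s4).
    have := braid4 s3K t3K s2K t2K (esym (q3_braid q23)) 1;
      rewrite !mul1r => ->.
    have -> : t3 * s4 * (t2 * t3 * s2) * s4 * s3 =
      t3 * (t2 * (s4 * t3 * s4 * s2 * s3)).
      by rewrite -(mulrA _ _ s4) !mulrA -(mulrA _ s2) s2s4 -(mulrA t3) -t2s4
        !mulrA.
    by apply: (DV3l); apply: (DV2l); apply: (D3r); apply: (D2r);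
      exact: M_pn D_M.
- have zC : s2 * t1 * s2 * s4 = s4 * (s2 * t1 * s2).
    by rewrite (comm_at _ s2s4) (comm_at _ t1s4) s2s4 !mulrA.
  have := slide_mixed q34 zC; rewrite /= (mixed_zE q4) !mulrA => ->.
  have -> : t3 * s4 * t2 * t1 * s3 * t2 * s3 * s1 * s2 * s4 * s3 =
      t3 * (t2 * (t1 * (s4 * s3 * t2 * s3 * s4 * s1 * s2 * s3))).
    rewrite !mulrA -!(comm_at _ t2s4) -!(comm_at _ t1s4) (comm_at _ s2s4).
    by rewrite (comm_at _ s1s4).
  apply: (DV3l); apply: (DV2l); apply: (DV1l); apply: (D3r); apply: (D2r);
    apply: (D1r).
  exact: M_ppnpp D_M.
(* For [wm] the slide is applied in the converse form and to the inverted generators, which keeps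
   [s4] on the left and [t4] on the right. *)
have zC : t2 * s1 * t2 * t4 = t4 * (t2 * s1 * t2).
  by rewrite (comm_at _ t2t4) (comm_at _ s1t4) t2t4 !mulrA.
have := slide_mixedC (q3pairV ua ub uc q34) zC.
rewrite /= (mixed_zEC (q4dataV ua ub uc q4)) !mulrA => ->.
have -> : t3 * t4 * t2 * t1 * t3 * s2 * t3 * s1 * s2 * t4 * s3 =
    t3 * (t2 * (t1 * (t4 * t3 * s2 * t3 * t4 * s1 * s2 * s3))).
  rewrite !mulrA -!(comm_at _ t2t4) -!(comm_at _ t1t4) (comm_at _ s2t4).
  by rewrite (comm_at _ s1t4).
apply: (DV3l); apply: (DV2l); apply: (DV1l); apply: (D3r); apply: (D2r);
  apply: (D1r).
exact: M_nnpnn D_M.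
Qed.

Lemma sandwich_s4_mem p : D (s4 * wp * s4) -> D (s4 * wm * s4) -> B4 p ->
  D (s4 * p * s4).
Proof.
by move=> Dp Dm; move: p; exact: (B4_ind ua ub uc q4 sandwich_s4).
Qed.

(** In the names, [spp] is [s4 wp s4] and [spm] is [s4 wm s4]. The property of [wp] is read in the
    pulled-back submodule, and [s1], [s2] commute with [s4]. *)
Lemma eig12_spp :
  D (s1 * (s4 * wp * s4) - a *: (s4 * wp * s4)) /\
  D (s2 * (s4 * wp * s4) - a *: (s4 * wp * s4)).
Proof.
have [] := wplus_eig_l ua ub uc q4 sandwich_s4.
by rewrite /= !(mulrBr, mulrBl) -!(scalerAr, scalerAl) !mulrA -s1s4 -s2s4.
Qed.

Lemma eig12_spm :
  D (s1 * (s4 * wm * s4) - a *: (s4 * wm * s4)) /\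
  D (s2 * (s4 * wm * s4) - a *: (s4 * wm * s4)).
Proof.
have [] := wminus_eig_l ua ub uc q4 sandwich_s4.
by rewrite /= !(mulrBr, mulrBl) -!(scalerAr, scalerAl) !mulrA -s1s4 -s2s4.
Qed.

Lemma eig3_spp : D (s3 * (s4 * wp * s4) - a *: (s4 * wp * s4)).
Proof.
apply: (conj_eig ua ub uc q23 Ds (M_bi2 D_M) (M_bi3 D_M) eig12_spp.2).
(* [s3] commutes with [s4 wp s4]: a braid move at each end, with [s4] crossing [s2 t1 s2] in
   between. *)
rewrite !mulrA; have := braid1 br34 1; rewrite !mul1r => ->.
have e p : p * s4 * s2 * t1 * s2 = p * s2 * t1 * s2 * s4.
  by rewrite -(comm_at _ s2s4) -(comm_at _ t1s4) -(comm_at _ s2s4).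
by rewrite e (braid1 (esym br34)).
Qed.

(* If [X = s4 (t3 z t3) s4] where [z] commutes with [s4], then
   [s3 X - a X = (s3 s4 t3 s4 - a s4 t3 s4) z s3 t4 t3]. By [rel_mulr] the first
   factor is a combination of words none of which ends in [t4 s3], so that
   [t4 (s3 z s3) t4], which need not be in [D], does not appear. *)
Lemma eig3_spm : D (s3 * (s4 * wm * s4) - a *: (s4 * wm * s4)).
Proof.
(* Keeping [z] abstract makes [mulrA] treat it as a single letter. *)
have [z zE] : exists z, z = t2 * s1 * t2 by exists (t2 * s1 * t2).
have s4zp p : p * s4 * z = p * z * s4.
  by rewrite zE !mulrA -(comm_at _ t2s4) -(comm_at _ s1s4) -(comm_at _ t2s4).
have t4zp p : p * t4 * z = p * z * t4.
  by rewrite zE !mulrA -(comm_at _ t2t4) -(comm_at _ s1t4) -(comm_at _ t2t4).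
have Dzl : lclosed z D by move=> d Dd; rewrite zE -!mulrA; apply: (DV2l);
  apply: (D1l); exact: DV2l.
have B1 : B4 s1 by apply: gen_gen; left; left.
have B2 : B4 s2 by apply: gen_gen; left; right.
have B3 : B4 s3 by apply: gen_gen; right.
have BV2 : B4 t2 by apply: (genV ua ub uc q23); left; right.
have BV3 : B4 t3 by apply: (genV ua ub uc q34); right.
have Bz : B4 z by rewrite zE; do 2?[apply: gen_mul => //].
(* [rel_mulr] is used in the pull-back of [D] along right multiplication by [z s3 t4 t3]; the seven
   goals are its closure conditions there. *)
have h : D ((s3 * s4 * t3 * s4 - a *: (s4 * t3 * s4)) * (z * s3 * t4 * t3)).
  have := rel_mulr ua ub uc q34 (subm_sandwich 1 (z * s3 * t4 * t3) Ds).
  rewrite /= !mul1r; apply.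
  - by move=> d /=; rewrite !mul1r -(mulrA s3); exact: D3l.
  - by rewrite -!mulrA; apply: (Dzl); apply: (D3l); apply: (DV3r);
      exact: M_t4 D_M.
  - rewrite !mulrA; apply: (DV3r); rewrite -(mulrA s4 z); apply: M_mixed.
    exact: gen_mul.
  - have -> : s4 * s3 * (z * s3 * t4 * t3) = s4 * (s3 * z * s3) * t4 * t3.
      by rewrite !mulrA.
    by apply: (DV3r); apply: M_mixed; do 2?[apply: gen_mul => //].
  - have -> : s4 * t3 * (z * s3 * t4 * t3) = s4 * (t3 * z * s3) * t4 * t3.
      by rewrite !mulrA.
    by apply: (DV3r); apply: M_mixed; do 2?[apply: gen_mul => //].
  - have := t4zp 1; rewrite !mul1r !mulrA => ->; rewrite -!mulrA; apply: (Dzl).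
    by rewrite !mulrA; apply: (DV3r); exact: M_np D_M.
  (* Here [t4] occurs on both sides, but [t3 z s3] contains [t3 s2 t3] as its core, which leads to
     the generator [t4 t3 s2 t3 t4]. *)
  - have e : t3 * z * s3 = s2 * s1 * (t3 * s2 * t3) * t1 * t2.
      by rewrite zE; exact: (mixed_zE (q4dataV ua ub uc q4)).
    have -> : t4 * t3 * (z * s3 * t4 * t3) =
      t4 * (t3 * z * s3) * t4 * t3 by rewrite !mulrA.
    have -> : t4 * (t3 * z * s3) * t4 * t3 =
       s2 * (s1 * (t4 * t3 * s2 * t3 * t4 * t1 * t2 * t3)).
      rewrite e !mulrA -s2t4 -(comm_at _ s1t4).
      by rewrite (comm_at _ t2t4) (comm_at _ t1t4).
    apply: (D2l); apply: (D1l); apply: (DV3r); apply: (DV2r); apply: (DV1r).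
    exact: M_nnpnn D_M.
(* This recovers the original word: [s4 z s3 t4 t3 = z t3 s4]. *)
have e1 p : p * s4 * (z * s3 * t4 * t3) = p * z * t3 * s4.
  by rewrite !mulrA s4zp (braid2 s4K t3K (esym br34)) (canc _ s3K).
have -> : s4 * wm * s4 = s4 * t3 * z * t3 * s4 by rewrite zE !mulrA.
by move: h; rewrite mulrBl -scalerAl !e1 !mulrA.
Qed.

Lemma eig_s4_l X s : [set s4 * wp * s4; s4 * wm * s4] X -> [set s1; s2; s3] s ->
  D (s * X - a *: X).
Proof.
by case=> ->; case=> [[]|] ->; [exact: eig12_spp.1 | exact: eig12_spp.2
  | exact: eig3_spp | exact: eig12_spm.1 | exact: eig12_spm.2
    | exact: eig3_spm].
Qed.

End Closed.
End Five.

(** * Inverse and converse forms for four generators *)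

Section FiveSymmetric.
Variables a b c : R.
Hypotheses (ua : a \is a GRing.unit) (ub : b \is a GRing.unit)
  (uc : c \is a GRing.unit).
Variables s1 t1 s2 t2 s3 t3 s4 t4 : A.
Hypothesis H : q5data a b c s1 t1 s2 t2 s3 t3 s4 t4.
Let HV := q5dataV ua ub uc H.
Let uaV : a^-1 \is a GRing.unit. Proof. by rewrite unitrV. Qed.
Let ubV : b^-1 \is a GRing.unit. Proof. by rewrite unitrV. Qed.
Let ucV : c^-1 \is a GRing.unit. Proof. by rewrite unitrV. Qed.

Notation wp := (s3 * s2 * t1 * s2 * s3).
Notation wm := (t3 * t2 * s1 * t2 * t3).
Notation B4 := (gen [set s1; s2; s3]).

Lemma M_closedV D :
  M_closed s1 s2 t2 s3 t3 s4 t4 D -> M_closed t1 t2 s2 t3 s3 t4 s4 D.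
Proof.
have [q4 q34 _ _] := H.
case=> Ds [l1 r1] [l2 r2] [l3 r3] *; split=> //; split.
- exact: (lclosedV ua ub uc (q3_x (q4_12 q4))).
- exact: (rclosedV ua ub uc (q3_x (q4_12 q4))).
- exact: (lclosedV ua ub uc (q3_x (q4_23 q4))).
- exact: (rclosedV ua ub uc (q3_x (q4_23 q4))).
- exact: (lclosedV ua ub uc (q3_x q34)).
- exact: (rclosedV ua ub uc (q3_x q34)).
Qed.

Lemma B4V : B4 `<=` gen [set t1; t2; t3].
Proof.
have [q4 q34 _ _] := HV.
apply: gen_ind; [exact: gen_sub | exact: gen1 |].
move=> g Gg p; apply: gen_mul; case: Gg => [[]|] ->.
- by apply: (genV uaV ubV ucV (q4_12 q4)); left; left.
- by apply: (genV uaV ubV ucV (q4_23 q4)); left; right.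
- by apply: (genV uaV ubV ucV q34); right.
Qed.

Section Closed.
Variable D : set A.
Hypothesis D_M : M_closed s1 s2 t2 s3 t3 s4 t4 D.

Lemma M_mixedV p : B4 p -> D (t4 * p * s4).
Proof. by move/B4V; exact: (M_mixed uaV ubV ucV HV (M_closedV D_M)). Qed.

Lemma sandwich_t4_mem p : D (t4 * wm * t4) -> D (t4 * wp * t4) -> B4 p ->
  D (t4 * p * t4).
Proof.
by move=> Dm Dp /B4V; exact: (sandwich_s4_mem uaV ubV ucV HV (M_closedV D_M)).
Qed.

(** Inversion takes [s4 wp s4] and [s4 wm s4] to [t4 wm t4] and [t4 wp t4]. *)
Lemma eig_t4_l X s : [set t4 * wm * t4; t4 * wp * t4] X -> [set s1; s2; s3] s ->
  D (s * X - a *: X).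
Proof.
have [q4 q34 _ _] := H; have Ds := M_sub D_M.
have eigV := eig_s4_l uaV ubV ucV HV (M_closedV D_M).
move=> XX [[]|] ->.
- apply: (eig_inv ua (cubicVr (q3_x (q4_12 q4))) Ds (M_bi1 D_M).1).
  by apply: eigV => //; left; left.
- apply: (eig_inv ua (cubicVr (q3_x (q4_23 q4))) Ds (M_bi2 D_M).1).
  by apply: eigV => //; left; right.
- apply: (eig_inv ua (cubicVr (q3_x q34)) Ds (M_bi3 D_M).1).
  by apply: eigV => //; right.
Qed.

Lemma eig_l X s :
    [set s4 * wp * s4; t4 * wm * t4; s4 * wm * s4; t4 * wp * t4] X ->
    [set s1; s2; s3] s ->
  D (s * X - a *: X).
Proof.
case=> [[[]|]|] -> Gs.
- by apply: (eig_s4_l ua ub uc H D_M) => //; left.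
- by apply: eig_t4_l => //; left.
- by apply: (eig_s4_l ua ub uc H D_M) => //; right.
- by apply: eig_t4_l => //; right.
Qed.

End Closed.
End FiveSymmetric.
End FiveStrands.

Lemma q5dataC (R : comUnitRingType) (A : algType R) (a b c : R)
    (s1 t1 s2 t2 s3 t3 s4 t4 : A) :
  q5data a b c s1 t1 s2 t2 s3 t3 s4 t4 ->
  q5data (A := A^c) a b c s1 t1 s2 t2 s3 t3 s4 t4.
Proof.
case=> q4 q34 c14 c24.
by split; [exact: q4dataC | exact: q3pairC | exact: esym | exact: esym].
Qed.

Lemma M_closedC (R : comUnitRingType) (A : algType R)
    (s1 s2 t2 s3 t3 s4 t4 : A) D :
  M_closed s1 s2 t2 s3 t3 s4 t4 D -> M_closed (A := A^c) s1 s2 t2 s3 t3 s4 t4 D.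
Proof.
case=> Ds [l1 r1] [l2 r2] [l3 r3] D1 Ds4 Dt4 Dpn Dnp Dp Dn; split=> //.
- by change (D (s4 * (t3 * s4))); rewrite mulrA.
- by change (D (t4 * (s3 * t4))); rewrite mulrA.
- by change (D (s4 * (s3 * (t2 * (s3 * s4))))); rewrite !mulrA.
- by change (D (t4 * (t3 * (s2 * (t3 * t4))))); rewrite !mulrA.
Qed.

(** The four elements are palindromes, hence the same in the converse algebra. *)
Lemma eig_r (R : comUnitRingType) (A : algType R) (a b c : R)
    (s1 t1 s2 t2 s3 t3 s4 t4 : A) (D : set A) X s :
  a \is a GRing.unit -> b \is a GRing.unit -> c \is a GRing.unit ->
  q5data a b c s1 t1 s2 t2 s3 t3 s4 t4 ->
  M_closed s1 s2 t2 s3 t3 s4 t4 D ->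
  let wp := s3 * s2 * t1 * s2 * s3 in let wm := t3 * t2 * s1 * t2 * t3 in
  [set s4 * wp * s4; t4 * wm * t4; s4 * wm * s4; t4 * wp * t4] X ->
  [set s1; s2; s3] s ->
  D (X * s - a *: X).
Proof.
move=> ua ub uc /q5dataC H /M_closedC D_M wp wm XX Gs.
have XX' : [set s4 * ((s3 * (s2 * (t1 * (s2 * s3)))) * s4);
     t4 * ((t3 * (t2 * (s1 * (t2 * t3)))) * t4);
     s4 * ((t3 * (t2 * (s1 * (t2 * t3)))) * s4);
     t4 * ((s3 * (s2 * (t1 * (s2 * s3)))) * t4)] X.
  by move: XX; rewrite /wp /wm !mulrA.
exact: (eig_l ua ub uc H D_M XX' Gs).
Qed.

(** * The bimodule generated by the image of the smaller algebra *)

Section Bimodule.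
Variables (R : comUnitRingType) (a b c : R) (A B : algType R).
Hypotheses (ua : a \is a GRing.unit) (ub : b \is a GRing.unit)
  (uc : c \is a GRing.unit).
Variables s1 t1 s2 t2 s3 t3 s4 t4 : A.
Hypothesis H : q5data a b c s1 t1 s2 t2 s3 t3 s4 t4.
Variables (f : {lrmorphism B -> A}) (eps : {lrmorphism B -> R^o}).
Variables g1 h1 g2 h2 g3 h3 : B.
(** [B] plays the part of [Q_4]; it enters through this induction over words in the generators and
    their inverses. *)
Hypothesis B_ind : forall D : set B, submodule D -> D 1 ->
  (forall g, [set g1; g2; g3] g -> lclosed g D) ->
  (forall h, [set h1; h2; h3] h -> lclosed h D) -> forall q, D q.
Hypotheses (fg1 : f g1 = s1) (fg2 : f g2 = s2) (fg3 : f g3 = s3).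
Hypotheses (fh1 : f h1 = t1) (fh2 : f h2 = t2) (fh3 : f h3 = t3).
Hypothesis eps_g : forall g, [set g1; g2; g3] g -> eps g = a.
Hypothesis eps_h : forall h, [set h1; h2; h3] h -> eps h = a^-1.

Definition subbimodule (M : set A) : Prop :=
  submodule M /\ forall (q : B) x, M x -> M (f q * x) /\ M (x * f q).

Let M : set A := smallest subbimodule
  [set 1; s4; t4; s4 * t3 * s4; s4 * s3 * t2 * s3 * s4; t4 * t3 * s2 * t3 * t4].

Notation wp := (s3 * s2 * t1 * s2 * s3).
Notation wm := (t3 * t2 * s1 * t2 * t3).
Notation X1 := (s4 * wp * s4).
Notation X2 := (t4 * wm * t4).
Notation X3 := (s4 * wm * s4).
Notation X4 := (t4 * wp * t4).
Notation B4 := (gen [set s1; s2; s3]).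
Notation closed := (M_closed s1 s2 t2 s3 t3 s4 t4).

Let q34 := q5_34 H.
Let q12 := q4_12 (q5_q4 H).
Let q23 := q4_23 (q5_q4 H).

Let fM u v : f (u * v) = f u * f v. Proof. exact: rmorphM. Qed.
Let epsM u v : eps (u * v) = eps u * eps v. Proof. exact: rmorphM. Qed.

Lemma image_gen q : B4 (f q).
Proof.
apply: (B_ind (D := [set q | B4 (f q)])).
- split; first by rewrite /= raddf0; exact: subm0 (gen_sub _).
  by move=> r u v /= Du Dv; rewrite linearP; apply: (gen_sub _).2.
- by rewrite /= rmorph1; exact: gen1.
- move=> g [[]|] -> u /= Du; rewrite fM ?fg1 ?fg2 ?fg3; apply: gen_l => //.
  + by left; left.
  + by left; right.
  + by right.
- move=> h [[]|] -> u /= Du; rewrite fM ?fh1 ?fh2 ?fh3; apply: gen_mul => //.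
  + by apply: (genV ua ub uc q12); left; left.
  + by apply: (genV ua ub uc q23); left; right.
  + by apply: (genV ua ub uc q34); right.
Qed.

Lemma subbimodule_closed D : subbimodule D ->
  [set 1; s4; t4; s4 * t3 * s4; s4 * s3 * t2 * s3 * s4; t4 * t3 * s2 * t3 * t4]
    `<=` D -> closed D.
Proof.
move=> [Ds Dbi] DD.
have bi q s : f q = s -> biclosed s D.
  by move=> <-; split=> d Dd; have [] := Dbi q d Dd.
apply: (M_closed_mk ua ub uc H) => //.
- exact: bi fg1.
- exact: bi fg2.
- exact: bi fg3.
- by apply: DD; do 5!left.
- by apply: DD; do 4!left; right.
- by apply: DD; do 3!left; right.
- by apply: DD; do 2!left; right.
- by apply: DD; left; right.
- by apply: DD; right.
Qed.

Lemma M_bimodule : subbimodule M.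
Proof.
split.
  split; first by move=> D [[Ds _] _]; exact: subm0.
  move=> r u v Mu Mv D HD; have [[Ds _] _] := HD.
  by apply: Ds.2; [exact: Mu | exact: Mv].
by move=> q x Mx; split=> D HD; have [[_ Dbi] _] := HD;
  have [] := Dbi q x (Mx D HD).
Qed.

Let M_M : closed M.
Proof.
by apply: subbimodule_closed; [exact: M_bimodule | move=> x Xx D [_]; exact].
Qed.

Lemma M_closed_adjoin D w : closed D ->
    (forall s, [set s1; s2; s3] s -> D (s * w - a *: w)) ->
    (forall s, [set s1; s2; s3] s -> D (w * s - a *: w)) ->
  closed (adjoin D w).
Proof.
case=> Ds [l1 r1] [l2 r2] [l3 r3] D1 Ds4 Dt4 Dpn Dnp Dp Dn wl wr.
have i1 : [set s1; s2; s3] s1 by left; left.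
have i2 : [set s1; s2; s3] s2 by left; right.
have i3 : [set s1; s2; s3] s3 by right.
split; try exact: adjoin_base; first exact: adjoin_sub.
- by split; [apply: (adjoin_lclosed (k := a)) => //; exact: wl
    | apply: (adjoin_rclosed (k := a)) => //; exact: wr].
- by split; [apply: (adjoin_lclosed (k := a)) => //; exact: wl
    | apply: (adjoin_rclosed (k := a)) => //; exact: wr].
- by split; [apply: (adjoin_lclosed (k := a)) => //; exact: wl
    | apply: (adjoin_rclosed (k := a)) => //; exact: wr].
Qed.

Let Xs : set A := [set X1; X2; X3; X4].

Lemma closed_adjoin_X D X : closed D -> Xs X -> closed (adjoin D X).
Proof.
move=> D_M XX; apply: M_closed_adjoin => // s Gs.
  exact: (eig_l ua ub uc H D_M XX Gs).
exact: (eig_r ua ub uc H D_M XX Gs).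
Qed.

Let M2 : set A := adjoin (adjoin (adjoin (adjoin M X1) X2) X3) X4.

Let Xs1 : Xs X1. Proof. by left; left; left. Qed.
Let Xs2 : Xs X2. Proof. by left; left; right. Qed.
Let Xs3 : Xs X3. Proof. by left; right. Qed.
Let Xs4 : Xs X4. Proof. by right. Qed.

Let N1 : set A := adjoin M X1.
Let N2 : set A := adjoin N1 X2.
Let N3 : set A := adjoin N2 X3.
Let N1_M : closed N1. Proof. exact: closed_adjoin_X. Qed.
Let N2_M : closed N2. Proof. exact: closed_adjoin_X. Qed.
Let N3_M : closed N3. Proof. exact: closed_adjoin_X. Qed.
Let M2_M : closed M2. Proof. exact: closed_adjoin_X. Qed.

Let M2_X X : Xs X -> M2 X.
Proof.
have [M_s N1_s N2_s N3_s] :=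
  And4 (M_sub M_M) (M_sub N1_M) (M_sub N2_M) (M_sub N3_M).
case=> [[[]|]|] ->; last exact: adjoin_new.
- by do 3![apply: adjoin_base => //]; exact: adjoin_new.
- by do 2![apply: adjoin_base => //]; exact: adjoin_new.
- by apply: adjoin_base => //; exact: adjoin_new.
Qed.

Lemma bimodule_mixed q : M (s4 * f q * t4) /\ M (t4 * f q * s4).
Proof.
split; first exact: (M_mixed ua ub uc H M_M (image_gen q)).
exact: (M_mixedV ua ub uc H M_M (image_gen q)).
Qed.

Let M_l q : lclosed (f q) M.
Proof. by move=> x Mx; case: (M_bimodule.2 q x Mx). Qed.

Let M_r q : rclosed (f q) M.
Proof. by move=> x Mx; case: (M_bimodule.2 q x Mx). Qed.

Let M_s : submodule M := M_sub M_M.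

(** [l u X - k e X = l (u X - e X) + e (l X - k X)]. *)
Lemma eig_mul_l X l u (k e : R) : M (f l * X - k *: X) -> M (f u * X - e *: X)
  ->
  M (f (l * u) * X - (k * e) *: X).
Proof.
move=> hl /(@M_l l _) hu; have := submD M_s hu (submZ M_s e hl).
by rewrite fM mulrBr mulrA -scalerAr scalerBr scalerA subrKA (mulrC e).
Qed.

Lemma eig_mul_r X l u (k e : R) : M (X * f l - k *: X) -> M (X * f u - e *: X)
  ->
  M (X * f (l * u) - (k * e) *: X).
Proof.
move=> /(@M_r u _) hl hu; have := submD M_s hl (submZ M_s k hu).
by rewrite fM mulrBl -mulrA -scalerAl scalerBr scalerA subrKA.
Qed.

Let fg g : [set g1; g2; g3] g -> [set s1; s2; s3] (f g).
Proof.
case=> [[]|] ->; rewrite ?fg1 ?fg2 ?fg3; first by left; left.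
  by left; right.
by right.
Qed.

Let eig_g X g : Xs X -> [set g1; g2; g3] g ->
  M (f g * X - a *: X) /\ M (X * f g - a *: X).
Proof.
by move=> XX /fg Gg; split;
  [exact: (eig_l ua ub uc H M_M XX Gg) | exact: (eig_r ua ub uc H M_M XX Gg)].
Qed.

Let eig_h X h : Xs X -> [set h1; h2; h3] h ->
  M (f h * X - a^-1 *: X) /\ M (X * f h - a^-1 *: X).
Proof.
move=> XX Hh.
have [g Gg [gh hg]] : exists2 g, [set g1; g2;
  g3] g & f g * f h = 1 /\ f h * f g = 1.
  have [c1 _ _ _] := q12; have [c2 c3 _ _] := q23.
  case: Hh => [[]|] ->; rewrite ?fh1 ?fh2 ?fh3.
  - exists g1; first by left; left.
    by rewrite fg1; case: c1.
  - exists g2; first by left; right.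
    by rewrite fg2; case: c2.
  - exists g3; first by right.
    by rewrite fg3; case: c3.
have [hl hr] := eig_g XX Gg; split.
  (* The roles are exchanged: [f h] is taken as the generator, [f g] as its inverse and [a^-1] as
     the eigenvalue. *)
  apply: (@eig_inv R A (f h) (f g) a^-1 M X) => //;
    [by rewrite unitrV | by rewrite invrK].
have /(@M_r h _) := hr; rewrite mulrBl -mulrA gh mulr1 -scalerAl.
move=> /(submZ M_s (- a^-1)); rewrite scalerBr scalerA mulNr mulVr // !scaleNr.
by rewrite scale1r opprK addrC.
Qed.

Let epsP r u v : eps (r *: u + v) = r * eps u + eps v.
Proof. exact: linearP. Qed.

Let fP r u v : f (r *: u + v) = r *: f u + f v.
Proof. exact: linearP. Qed.

Let f0 : f 0 = 0. Proof. exact: raddf0. Qed.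
Let f1 : f 1 = 1. Proof. exact: rmorph1. Qed.
Let eps0 : eps 0 = 0. Proof. exact: raddf0. Qed.
Let eps1 : eps 1 = 1. Proof. exact: rmorph1. Qed.

Lemma bimodule_eig_l X l : Xs X -> M (f l * X - (eps l : R) *: X).
Proof.
move=> XX; apply: (B_ind (D := [set l | M (f l * X - (eps l : R) *: X)])) => /=.
- split; first by rewrite /= f0 eps0 mul0r scale0r subr0; exact: (subm0 M_s).
  move=> r u v /= Mu Mv; have := M_s.2 r _ _ Mu Mv; congr M.
  by rewrite fP epsP mulrDl -scalerAl scalerBr scalerDl scalerA opprD addrACA.
- by rewrite f1 eps1 mul1r scale1r subrr; exact: (subm0 M_s).
- move=> g Gg u /= Mu; rewrite epsM (eps_g Gg); apply: eig_mul_l => //.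
  by have [] := eig_g XX Gg.
- move=> h Hh u /= Mu; rewrite epsM (eps_h Hh); apply: eig_mul_l => //.
  by have [] := eig_h XX Hh.
Qed.

Lemma bimodule_eig_r X l : Xs X -> M (X * f l - (eps l : R) *: X).
Proof.
move=> XX; apply: (B_ind (D := [set l | M (X * f l - (eps l : R) *: X)])) => /=.
- split; first by rewrite /= f0 eps0 mulr0 scale0r subr0; exact: (subm0 M_s).
  move=> r u v /= Mu Mv; have := M_s.2 r _ _ Mu Mv; congr M.
  by rewrite fP epsP mulrDr -scalerAr scalerBr scalerDl scalerA opprD addrACA.
- by rewrite f1 eps1 mulr1 scale1r subrr; exact: (subm0 M_s).
- move=> g Gg u /= Mu; rewrite epsM (eps_g Gg); apply: eig_mul_r => //.
  by have [] := eig_g XX Gg.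
- move=> h Hh u /= Mu; rewrite epsM (eps_h Hh); apply: eig_mul_r => //.
  by have [] := eig_h XX Hh.
Qed.

Lemma bimodule_eig X l : Xs X ->
  congr_mod M (f l * X) (X * f l) /\ congr_mod M (X * f l) ((eps l : R) *: X).
Proof.
move=> XX; have hl := bimodule_eig_l l XX; have hr := bimodule_eig_r l XX.
by split=> //; exact: (submBT M_s hl (submBC M_s hr)).
Qed.

Let U : set A := [set x | exists r t t' : R, x = r%:A + t *: s4 + t' *: t4].

Let S : set A := Rspan [set x | exists (p q r : B) (u v : A),
  [/\ U u, U v & x = f p * u * f q * v * f r]].

Lemma U_ind D : submodule D -> D 1 -> D s4 -> D t4 -> U `<=` D.
Proof.
by move=> Ds D1 Ds4 Dt4 _ [r [t [t' ->]]]; do 2?[apply: (submD Ds)];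
  exact: (submZ Ds).
Qed.

(** As [M2] is stable under [f q] on both sides, there remain the products [u f(q) v] with [u] and
    [v] among [1], [s4], [t4]. Opposite letters are covered by the mixed lemmas, equal ones by the
    four adjoined elements. *)
Lemma S_sub2 : S `<=` M2.
Proof.
have Ms2 := M_sub M2_M.
have Gl q : lclosed (f q) M2.
  apply: (gen_lclosed Ms2 _ (image_gen q)) => g [[]|] ->;
    [exact: (M_bi1 M2_M).1 | exact: (M_bi2 M2_M).1 | exact: (M_bi3 M2_M).1].
have Gr q : rclosed (f q) M2.
  apply: (gen_rclosed Ms2 _ (image_gen q)) => g [[]|] ->;
    [exact: (M_bi1 M2_M).2 | exact: (M_bi2 M2_M).2 | exact: (M_bi3 M2_M).2].
move=> x; apply; split=> // _ [p [q [r [u [v [Uu Uv ->]]]]]].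
apply: (Gr); rewrite -!(mulrA (f p)); apply: (Gl).
have [M21 M2s4 M2t4] := And3 (M_1 M2_M) (M_s4 M2_M) (M_t4 M2_M).
have [XX1 XX2] := (M2_X Xs1, M2_X Xs2); have [XX3 XX4] := (M2_X Xs3, M2_X Xs4).
have step w : M2 (w * f q * 1) -> M2 (w * f q * s4) -> M2 (w * f q * t4) ->
    M2 (w * f q * v).
  move=> w1 w2 w3.
  have := U_ind (subm_sandwich (w * f q) 1 Ms2) _ _ _ Uv.
  by rewrite /= !mulr1; apply=> //; rewrite -[w * f q]mulr1.
have := U_ind (subm_sandwich 1 (f q * v) Ms2) _ _ _ Uu.
rewrite /= !mulrA !mul1r; apply.
- rewrite -[f q]mul1r; apply: step; rewrite mul1r; exact: Gl.
- apply: step; first by rewrite mulr1; exact: Gr.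
    exact: (sandwich_s4_mem ua ub uc H M2_M XX1 XX3 (image_gen q)).
  exact: (M_mixed ua ub uc H M2_M (image_gen q)).
- apply: step; first by rewrite mulr1; exact: Gr.
    exact: (M_mixedV ua ub uc H M2_M (image_gen q)).
  exact: (sandwich_t4_mem ua ub uc H M2_M XX2 XX4 (image_gen q)).
Qed.

Let S_s : submodule S.
Proof.
split; first by move=> D [Ds _]; exact: subm0.
move=> r u v Su Sv D HD; have [Ds _] := HD.
by apply: Ds.2; [exact: Su | exact: Sv].
Qed.

Let S_UU u q v : U u -> U v -> S (u * f q * v).
Proof.
move=> Uu Uv D [_]; apply; exists 1, q, 1, u, v; split=> //.
by rewrite f1 mul1r mulr1.
Qed.

Let S_bi : subbimodule S.
Proof.
split=> // q x Sx; split.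
  have Ds := subm_sandwich (f q) 1 S_s.
  have : [set d | S (f q * d * 1)] x.
    apply: Sx; split=> // _ [p [q' [r [u [v [Uu Uv ->]]]]]] /=.
    rewrite mulr1 => D [_]; apply; exists (q * p), q', r, u, v; split=> //.
    by rewrite fM !mulrA.
  by rewrite /= mulr1.
have Ds := subm_sandwich 1 (f q) S_s.
have : [set d | S (1 * d * f q)] x.
  apply: Sx; split=> // _ [p [q' [r [u [v [Uu Uv ->]]]]]] /=.
  rewrite mul1r => D [_]; apply; exists p, q', (r * q), u, v; split=> //.
  by rewrite fM !mulrA.
by rewrite /= mul1r.
Qed.

Let U1 : U 1.
Proof. by exists 1, 0, 0; rewrite !scale0r !addr0 scale1r. Qed.
Let Us4 : U s4.
Proof. by exists 0, 1, 0; rewrite !scale0r add0r addr0 scale1r. Qed.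
Let Ut4 : U t4.
Proof. by exists 0, 0, 1; rewrite !scale0r !add0r scale1r. Qed.

Lemma M_subS : M `<=` S.
Proof.
move=> x; apply; split=> // y; case=> [[[[[]|]|]|]|] ->.
- by have := S_UU 1 U1 U1; rewrite f1 !mulr1.
- by have := S_UU 1 Us4 U1; rewrite f1 !mulr1.
- by have := S_UU 1 Ut4 U1; rewrite f1 !mulr1.
- by have := S_UU h3 Us4 Us4; rewrite fh3.
- by have := S_UU (g3 * h2 * g3) Us4 Us4; rewrite !fM fg3 fh2 !mulrA.
- by have := S_UU (h3 * g2 * h3) Ut4 Ut4; rewrite !fM fg2 fh3 !mulrA.
Qed.

Lemma Xs_subS : Xs `<=` S.
Proof.
have wpE : f (g3 * g2 * h1 * g2 * g3) = wp by rewrite !fM fg2 fg3 fh1.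
have wmE : f (h3 * h2 * g1 * h2 * h3) = wm by rewrite !fM fg1 fh2 fh3.
by move=> X [[[]|]|] ->; rewrite -?wpE -?wmE; exact: S_UU.
Qed.

Lemma bimodule_span :
  S = [set x | exists (y : A) (r1 r2 r3 r4 : R), M y /\
        x = y + r1 *: X1 + r2 *: X2 + r3 *: X3 + r4 *: X4].
Proof.
apply/seteqP; split=> x.
  move=> /S_sub2 [r4 [r3 [r2 [r1 My]]]].
  exists (x - r4 *: X4 - r3 *: X3 - r2 *: X2 - r1 *: X1), r1, r2, r3, r4.
  by split=> //; rewrite !subrK.
move=> [y [r1 [r2 [r3 [r4 [My ->]]]]]].
have SZ r X : Xs X -> S (r *: X) by move=> /Xs_subS; exact: submZ.
by do 4?[apply: (submD S_s)]; [exact: M_subS | exact: SZ ..].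
Qed.

End Bimodule.

(** * The algebras Q_4 and Q_5 *)

Section Conjugation.
Variables (R : comUnitRingType) (a b c : R) (A : algType R).

(** The relator is moved through [g] by [x' g = g x], and [g] is then cancelled by its right inverse
    [h]. *)
Lemma cubic_conj (x X x' X' g h : A) : cubic a b c x X ->
  x' * X' = 1 -> X' * x' = 1 -> g * h = 1 -> x' * g =
    g * x -> cubic a b c x' X'.
Proof.
move=> [_ _ e] x'K X'K gh x'g; split=> //.
have shift k : (x' - k%:A) * g = g * (x - k%:A).
  by rewrite mulrBl mulrBr x'g mulr_algl mulr_algr.
rewrite -[LHS]mulr1 -gh mulrA /cubic_relator -!mulrA (mulrA _ g) shift.
rewrite -(mulrA g) (mulrA _ g) shift -(mulrA g) (mulrA _ g) shift -(mulrA g).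
by rewrite [X in g * X]mulrA [X in g * X]mulrA -/(cubic_relator a b c x) e
  mul0r mulr0.
Qed.

Lemma q3pair_conj (x X y Y x' X' y' Y' g h : A) : q3pair a b c x X y Y ->
    x' * X' = 1 -> X' * x' = 1 -> y' * Y' = 1 -> Y' * y' = 1 -> g * h = 1 ->
    x' * g = g * x -> y' * g = g * y -> x' * y' * x' = y' * x' * y' ->
  q3pair a b c x' X' y' Y'.
Proof.
move=> [cx cy br rel] x'K X'K y'K Y'K gh x'g y'g br'; split=> //.
- exact: (cubic_conj cx x'K X'K gh).
- exact: (cubic_conj cy y'K Y'K gh).
have inv_shift u U u' U' : u * U = 1 -> U' * u' = 1 -> u' * g = g * u ->
    U' * g = g * U.
  move=> uK U'K e.
  by rewrite -[U' * g]mulr1 -uK !mulrA -(mulrA U') -e mulrA U'K mul1r.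
have X'g : X' * g = g * X by apply: (inv_shift x X x'); first by case: cx.
have Y'g : Y' * g = g * Y by apply: (inv_shift y Y y'); first by case: cy.
rewrite -[LHS]mulr1 -gh mulrA.
suff -> : Q_relator a x' y' X' Y' * g = g * Q_relator a x y X Y.
  by rewrite rel mulr0 mul0r.
have sh u U : u * g = g * U -> forall p, p * u * g = p * g * U.
  by move=> e p; rewrite -!mulrA e.
rewrite /Q_relator; expand.
by rewrite !(sh _ _ x'g, sh _ _ y'g, sh _ _ X'g, sh _ _ Y'g, x'g, y'g, X'g,
  Y'g).
Qed.

(* [s1 s2 s3] conjugates [s1], [s2] to [s2], [s3], and [s2 s3 s4] conjugates
   [s2], [s3] to [s3], [s4]. *)
Lemma q5data_braid (s1 t1 s2 t2 s3 t3 s4 t4 : A) :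
    s1 * t1 = 1 -> t1 * s1 = 1 -> s2 * t2 = 1 -> t2 * s2 = 1 ->
    s3 * t3 = 1 -> t3 * s3 = 1 -> s4 * t4 = 1 -> t4 * s4 = 1 ->
    s1 * s3 = s3 * s1 -> s1 * s4 = s4 * s1 -> s2 * s4 = s4 * s2 ->
    s1 * s2 * s1 = s2 * s1 * s2 -> s2 * s3 * s2 = s3 * s2 * s3 ->
    s3 * s4 * s3 = s4 * s3 * s4 ->
    cubic_relator a b c s1 = 0 -> Q_relator a s1 s2 t1 t2 = 0 ->
  q5data a b c s1 t1 s2 t2 s3 t3 s4 t4.
Proof.
move=> s1K t1K s2K t2K s3K t3K s4K t4K c13 c14 c24 br12 br23 br34 cub rel.
have cub1 : cubic a b c s1 t1 by split.
(* The element [s1 s2] already conjugates [s1] to [s2]. *)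
have cub2 : cubic a b c s2 t2.
  apply: (cubic_conj cub1 s2K t2K (g := s1 * s2) (h := t2 * t1)).
    by rewrite mulrA (canc _ s2K).
  by rewrite mulrA br12.
have q12 : q3pair a b c s1 t1 s2 t2 by split.
have q23 : q3pair a b c s2 t2 s3 t3.
  apply: (q3pair_conj q12 (g := s1 * s2 * s3) (h := t3 * t2 * t1)) => //.
  - by rewrite !mulrA (canc _ s3K) (canc _ s2K).
  - by rewrite !mulrA -br12 (comm_at _ c13).
  - by rewrite !mulrA -c13 -(braid1 br23).
have q34 : q3pair a b c s3 t3 s4 t4.
  apply: (q3pair_conj q23 (g := s2 * s3 * s4) (h := t4 * t3 * t2)) => //.
  - by rewrite !mulrA (canc _ s4K) (canc _ s3K).
  - by rewrite !mulrA -br23 (comm_at _ c24).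
  - by rewrite !mulrA -c24 -(braid1 br34).
exact: (Q5data (Q4data q12 q23 c13) q34 c14 c24).
Qed.

End Conjugation.

(** * Induction over Q_n and the maps from Q_4 *)

Lemma galg_sum (R : nzRingType) (G : groupType) (x : galg R G) :
  x = \sum_(k <- msupp x) x@_k *: gdelta R k.
Proof.
rewrite [LHS]monalgE; apply: eq_bigr => k _.
by rewrite [RHS]galg_scaleU mulr1.
Qed.

Section QInduction.
Local Open Scope quotient_scope.
Variables (P : coeff) (n : nat).

Lemma Q_piZ (r : P) (u : RB P n) : Q_pi (r *: u) = r *: Q_pi u.
Proof. exact: linearZ. Qed.

(** Every element is a linear combination of images of braids, and a braid is represented by a word
    in the generators and their inverses, on which the induction runs. *)
Lemma Q_ind (D : set (Q P n)) : submodule D -> D 1 ->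
    (forall i, lclosed (Q_gen P i) D) -> (forall i, lclosed (Q_genV P i) D) ->
  forall q, D q.
Proof.
move=> Ds D1 Dg DV q; have [x ->] := quotalg_pi_surj q.
have Dk (k : braid n) : D (Q_pi (gdelta P k)).
  elim/braidW: k; elim=> [|[i e] w IH]; first by rewrite [Q_pi _]rmorph1.
  have -> : \pi_(braid n) ((i, e) :: w) =
      ((if e then braid_gen i else (braid_gen i)^-1) * \pi_(braid n) w)%g.
    rewrite (fun_if (fun g => (g * _)%g)) braid_genV.
    by case: e; rewrite [RHS]braid_mulE.
  by rewrite Q_piM; case: e; [exact: Dg | exact: DV].
pose E : set (RB P n) := [set u | D (Q_pi u)].
have Es : submodule E.
  split; first by rewrite /E /= raddf0; exact: subm0.
  by move=> r u v; rewrite /E /= raddfD /= Q_piZ; apply: Ds.2.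
suff Ex : E x by exact: Ex.
rewrite (galg_sum x); elim/big_ind: _.
- exact: (subm0 Es).
- exact: (submD Es).
- by move=> k _; exact: (submZ Es (x@_k : P) (Dk k)).
Qed.

End QInduction.

Lemma Q5_q5data (P : coeff) :
  q5data (pa P) (pb P) (pc P) s1 s1V s2 s2V s3 s3V s4 (s4V : Q P 5).
Proof.
pose o1 : 'I_5.-1 := @Ordinal 4 0 isT.
pose o2 : 'I_5.-1 := @Ordinal 4 1 isT.
pose o3 : 'I_5.-1 := @Ordinal 4 2 isT.
pose o4 : 'I_5.-1 := @Ordinal 4 3 isT.
apply: q5data_braid.
- exact: (@Q_genVK P 5 o1).
- exact: (@Q_genKV P 5 o1).
- exact: (@Q_genVK P 5 o2).
- exact: (@Q_genKV P 5 o2).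
- exact: (@Q_genVK P 5 o3).
- exact: (@Q_genKV P 5 o3).
- exact: (@Q_genVK P 5 o4).
- exact: (@Q_genKV P 5 o4).
- exact: (@Q_gen_comm P 5 o1 o3).
- exact: (@Q_gen_comm P 5 o1 o4).
- exact: (@Q_gen_comm P 5 o2 o4).
- exact: (@Q_gen_artin P 5 o1 o2).
- exact: (@Q_gen_artin P 5 o2 o3).
- exact: (@Q_gen_artin P 5 o3 o4).
- exact: (@Q_gen_cubic P 5 o1).
- exact: (@Q_gen_rel P 5 o1 o2).
Qed.

Lemma morph_inv (A B : pzRingType) (f : {rmorphism B -> A}) (g h : B) (s t : A) :
  f g = s -> g * h = 1 -> t * s = 1 -> f h = t.
Proof.
move=> fg gh ts; have := rmorphM f g h; rewrite gh rmorph1 fg => e.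
by rewrite -[f h]mul1r -ts -mulrA -e mulr1.
Qed.

Section InstanceFour.
Variable P : coeff.

Definition sigma1 : Q P 4 := @Q_gen P 4 (@Ordinal 3 0 isT).
Definition sigma2 : Q P 4 := @Q_gen P 4 (@Ordinal 3 1 isT).
Definition sigma3 : Q P 4 := @Q_gen P 4 (@Ordinal 3 2 isT).
Definition sigma1V : Q P 4 := @Q_genV P 4 (@Ordinal 3 0 isT).
Definition sigma2V : Q P 4 := @Q_genV P 4 (@Ordinal 3 1 isT).
Definition sigma3V : Q P 4 := @Q_genV P 4 (@Ordinal 3 2 isT).

Lemma Q4_ind (D : set (Q P 4)) : submodule D -> D 1 ->
  (forall g, [set sigma1; sigma2; sigma3] g -> lclosed g D) ->
  (forall h, [set sigma1V; sigma2V; sigma3V] h -> lclosed h D) -> forall q, D q.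
Proof.
move=> Ds D1 Dg Dh; apply: Q_ind => // -[[|[|[|//]]] i3].
- by apply: Dg; left; left; congr (Q_gen P _); exact: val_inj.
- by apply: Dg; left; right; congr (Q_gen P _); exact: val_inj.
- by apply: Dg; right; congr (Q_gen P _); exact: val_inj.
- by apply: Dh; left; left; congr (Q_genV P _); exact: val_inj.
- by apply: Dh; left; right; congr (Q_genV P _); exact: val_inj.
- by apply: Dh; right; congr (Q_genV P _); exact: val_inj.
Qed.

Lemma Q45_sigma1 : Q45 sigma1 = s1.
Proof. by rewrite [LHS]Q_nat_gen; congr (Q_gen P _); exact: val_inj. Qed.
Lemma Q45_sigma2 : Q45 sigma2 = s2.
Proof. by rewrite [LHS]Q_nat_gen; congr (Q_gen P _); exact: val_inj. Qed.
Lemma Q45_sigma3 : Q45 sigma3 = s3.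
Proof. by rewrite [LHS]Q_nat_gen; congr (Q_gen P _); exact: val_inj. Qed.

Lemma Q45_sigma1V : Q45 sigma1V = s1V.
Proof. exact: (morph_inv Q45_sigma1 (Q_genVK _ _) (Q_genKV _ _)). Qed.
Lemma Q45_sigma2V : Q45 sigma2V = s2V.
Proof. exact: (morph_inv Q45_sigma2 (Q_genVK _ _) (Q_genKV _ _)). Qed.
Lemma Q45_sigma3V : Q45 sigma3V = s3V.
Proof. exact: (morph_inv Q45_sigma3 (Q_genVK _ _) (Q_genKV _ _)). Qed.

Lemma eps4_sigma g : [set sigma1; sigma2; sigma3] g -> eps4 g = pa P.
Proof. by case=> [[]|] ->; exact: Q_eps_gen. Qed.

Lemma eps4_sigmaV h : [set sigma1V; sigma2V; sigma3V] h -> eps4 h = (pa P)^-1.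
Proof.
have aK : (pa P)^-1 * pa P = 1 by exact: mulVr (pa_unit P).
pose inv := fun i => @morph_inv P^o (Q P 4) (@eps4 P) _ _ _ _ (Q_eps_gen P i)
  (Q_genVK P i) aK.
by case=> [[]|] ->; exact: inv.
Qed.

End InstanceFour.

Theorem proposition5p2 :
  [/\ forall q : Q Zabc 4, Q5_15 Zabc (s4 * Q45 q * s4V)
    & forall q : Q Zabc 4, Q5_15 Zabc (s4V * Q45 q * s4)]
  /\
  [/\ Q5_2 Zabc =
      [set x | exists (y : Q Zabc 5) (r1 r2 r3 r4 : Zabc), Q5_15 Zabc y /\
        x = y + r1 *: (s4 * w_plus * s4) + r2 *: (s4V * w_minus * s4V)
              + r3 *: (s4 * w_minus * s4) + r4 *: (s4V * w_plus * s4V)]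
    & forall X : Q Zabc 5,
        [set s4 * w_plus * s4; s4V * w_minus * s4V;
             s4 * w_minus * s4; s4V * w_plus * s4V] X ->
        forall l : Q Zabc 4,
          congr_mod (Q5_15 Zabc) (Q45 l * X) (X * Q45 l) /\
          congr_mod (Q5_15 Zabc) (X * Q45 l) (eps4 l *: X)].
Proof.
have ua : pa Zabc \is a GRing.unit := la_unit.
(* The record [coeff] only asks that [a] be a unit; in the Laurent ring [b] and [c] are units as
   well, being monomials. *)
have ub : pb Zabc \is a GRing.unit by exact: lmon_unit.
have uc : pc Zabc \is a GRing.unit by exact: lmon_unit.
have H := Q5_q5data Zabc.
have ind := @Q4_ind Zabc.
have e1 := @Q45_sigma1 Zabc; have e2 := @Q45_sigma2 Zabc;
  have e3 := @Q45_sigma3 Zabc.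
have f1 := @Q45_sigma1V Zabc; have f2 := @Q45_sigma2V Zabc;
  have f3 := @Q45_sigma3V Zabc.
split; split.
- move=> q; exact: (bimodule_mixed ua ub uc H ind e1 e2 e3 f1 f2 f3 q).1.
- move=> q; exact: (bimodule_mixed ua ub uc H ind e1 e2 e3 f1 f2 f3 q).2.
- exact: (bimodule_span ua ub uc H ind e1 e2 e3 f1 f2 f3).
- move=> X XX l; exact: (bimodule_eig ua ub uc H ind e1 e2 e3 f1 f2 f3
    (@eps4_sigma Zabc) (@eps4_sigmaV Zabc) l XX).
Qed.
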